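(* Let $k$ be a field and $n\in\mathbb N$. (1) There is a canonical isomorphism between the lattice of thick subcategories of $\mathcal A_n$ and the lattice $\mathrm{NC}(n+1)$. (2) There is a canonical isomorphism between the lattice of thick subcategories of $\tilde{\mathcal A}_n$ and the lattice $\mathrm{NC}^B(n)$.
   Context: $\mathbb N=\{0,1,2,\dots\}$. $\mathcal A_n$ is the category of finite dimensional $k$-linear representations $M(n-1)\to\cdots\to M(1)\to M(0)$ of the linearly oriented quiver with $n$ vertices. For $n\ge1$, $\tilde{\mathcal A}_n$ is the category of finite dimensional nilpotent $k$-linear representations of the cyclic quiver $n-1\to n-2\to\cdots\to1\to0\to n-1$; $\tilde{\mathcal A}_0=0$. A full subcategory of an abelian category is thick if it is closed under direct summands and satisfies the two out of three property for short exact sequences (if two terms belong to the subcategory, then so does the third). Thick subcategories are ordered by inclusion. A partition of $\{0,1,\dots,m-1\}$ is non-crossing if, whenever $i<j<i'<j'$ with $i,i'$ in the same part and $j,j'$ in the same part, all four elements belong to the same part. $\mathrm{NC}(m)$ is the lattice of non-crossing partitions of $\{0,\dots,m-1\}$, ordered by refinement ($P\le P'$ if every part of $P$ is contained in a part of $P'$). $\mathrm{NC}^B(n)$ is the lattice of those non-crossing partitions $P$ of $[2n]=\{0,1,\dots,2n-1\}$ such that for each part $P_\alpha$ also $\overline{P_\alpha}$ is a part, where $\bar x=x+n$ for $0\le x<n$ and $\bar{\bar x}=x$; it is ordered by refinement. *)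

(* Defs.v *)
From HB Require Import structures.
From mathcomp Require Import all_boot all_order all_algebra.

Set Implicit Arguments.
Unset Strict Implicit.
Unset Printing Implicit Defensive.

Import GRing.Theory.
Local Open Scope ring_scope.

Record quiver := Quiver {
  vertex : finType;
  arrow : finType;
  source : arrow -> vertex;
  target : arrow -> vertex
}.

Record rep (k : fieldType) (Q : quiver) := Rep {
  rep_space :> vertex Q -> vectType k;
  rep_act : forall a : arrow Q, 'Hom(rep_space (source a), rep_space (target a))
}.

Section Representations.
Variables (k : fieldType) (Q : quiver).
Implicit Types (M N X Y Z : rep k Q).

Definition is_rep_hom M N (f : forall v, 'Hom(M v, N v)) : Prop :=
  forall a : arrow Q, (rep_act N a \o f (source a) = f (target a) \o rep_act M a)%VF.

Definition rep_iso M N : Prop :=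
  exists (f : forall v, 'Hom(M v, N v)) (g : forall v, 'Hom(N v, M v)),
    [/\ is_rep_hom f, is_rep_hom g,
        forall v, (g v \o f v = \1)%VF & forall v, (f v \o g v = \1)%VF].

Definition rep_sum M N : rep k Q :=
  @Rep k Q (fun v => (M v * N v)%type : vectType k)
    (fun a => linfun (fun x => (rep_act M a x.1, rep_act N a x.2))).

(* Kernels and images of morphisms of representations are computed vertexwise. *)
Definition short_exact X Y Z
    (f : forall v, 'Hom(X v, Y v)) (g : forall v, 'Hom(Y v, Z v)) : Prop :=
  [/\ is_rep_hom f, is_rep_hom g,
      forall v, lker (f v) = 0%VS,
      forall v, limg (f v) = lker (g v) & forall v, limg (g v) = fullv].

(* A full subcategory is given by its class of objects.  The parameter [A]     *)
(* is the ambient abelian category, a full exact subcategory of [rep k Q].     *)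
(* Nonemptiness (equivalently, containing the zero object) is implicit in the  *)
(* usual definition; without it the empty class would qualify.                 *)
Record thick (A C : rep k Q -> Prop) : Prop := Thick {
  thick_sub : forall M, C M -> A M;
  thick_nonempty : exists M, C M;
  thick_summand : forall M N X,
    A M -> A N -> C X -> rep_iso X (rep_sum M N) -> C M;
  thick_2of3 : forall X Y Z
    (f : forall v, 'Hom(X v, Y v)) (g : forall v, 'Hom(Y v, Z v)),
    A X -> A Y -> A Z -> short_exact f g ->
    [/\ C X -> C Y -> C Z, C X -> C Z -> C Y & C Y -> C Z -> C X]
}.

Definition thick_subcategory (A : rep k Q -> Prop) :=
  {C : rep k Q -> Prop | thick A C}.

Definition thick_le A (C D : thick_subcategory A) : Prop :=
  forall M, sval C M -> sval D M.

End Representations.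

Definition linear_quiver (n : nat) : quiver :=
  @Quiver 'I_n {p : 'I_n * 'I_n | p.1 == p.2.+1 :> nat}
    (fun a => (val a).1) (fun a => (val a).2).

(* The arrow indexed by [i] goes from [i] to [i - 1] modulo [n].               *)
Definition cyclic_quiver (n : nat) : quiver :=
  @Quiver 'I_n 'I_n (fun i => i) (@ord_pred n).

Definition cat_A (k : fieldType) (n : nat) (M : rep k (linear_quiver n)) : Prop :=
  True.

(* The action of the path of length [l] starting at [v].                       *)
Fixpoint path_act (k : fieldType) (n : nat) (M : rep k (cyclic_quiver n))
    (l : nat) (v : 'I_n) : 'Hom(M v, M (iter l (@ord_pred n) v)) :=
  if l is l'.+1 return 'Hom(M v, M (iter l (@ord_pred n) v))
  then (rep_act M (iter l' (@ord_pred n) v : arrow (cyclic_quiver n))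
          \o path_act M l' v)%VF
  else \1%VF.

Definition cat_At (k : fieldType) (n : nat) (M : rep k (cyclic_quiver n)) : Prop :=
  exists l : nat, forall v : 'I_n, path_act M l v = 0.

(* The indecomposable of A_n with support the vertices [i <= v < j].           *)
Definition interval_rep (k : fieldType) (n i j : nat) : rep k (linear_quiver n) :=
  @Rep k (linear_quiver n) (fun v : 'I_n => 'rV[k]_(i <= v < j))
    (fun a => linfun (mulmxr (const_mx 1))).

(* For [i < j <= i + n], the uniserial representation with basis               *)
(* [e_i, ..., e_(j-1)], where [e_t] sits at the vertex [t mod n] and the arrows *)
(* send [e_t] to [e_(t-1)] for [t > i] and [e_i] to [0].  As [j <= i + n],      *)
(* every vertex carries at most one basis vector.                              *)
Definition uniserial_rep (k : fieldType) (n i j : nat) : rep k (cyclic_quiver n) :=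
  @Rep k (cyclic_quiver n)
    (fun v : 'I_n =>
       'rV[k]_([exists t : 'I_j, (i <= t)%N && (t == v %[mod n])%N]))
    (fun v : 'I_n => linfun (mulmxr (const_mx (v != i %[mod n])%N%:R))).

Definition noncrossing (m : nat) (P : {set {set 'I_m}}) : bool :=
  [forall A in P, forall B in P,
   forall i in A, forall i' in A, forall j in B, forall j' in B,
   [&& i < j, j < i' & i' < j']%N ==> (A == B)].

Definition NC (m : nat) :=
  {P : {set {set 'I_m}} | partition P [set: 'I_m] && noncrossing P}.

(* [x + n] for [x < n] and [x - n] for [n <= x].                               *)
Definition bar (n : nat) (x : 'I_(n + n)) : 'I_(n + n) :=
  match split x with inl i => rshift n i | inr i => lshift n i end.

Definition NCB (n : nat) :=
  {P : {set {set 'I_(n + n)}} |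
    [&& partition P [set: 'I_(n + n)], noncrossing P &
        [forall A in P, [set bar x | x in A] \in P]]}.

Definition refines (T : finType) (P P' : {set {set T}}) : bool :=
  [forall A in P, exists B in P', A \subset B].

(* Main.v *)
Require Import Defs.
From HB Require Import structures.
From mathcomp Require Import all_boot all_order all_algebra.
From mathcomp Require Import boolp.
From mathcomp Require Import zify.

Set Implicit Arguments.
Unset Strict Implicit.
Unset Printing Implicit Defensive.

Import GRing.Theory.
Local Open Scope ring_scope.

(* The maps between the spaces of a representation [M] along paths of the       *)
(* quiver compute [Hom(X, M)] and [Ext(X, M)] for the strings [X]: for the      *)
(* string with top at position [b - 1] and socle at position [a], both vanish   *)
(* exactly when the path from [b - 1] to [a - 1] acts bijectively.  By the five *)
(* lemma, requiring this for any set of strings defines a thick subcategory.    *)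
(* Given a noncrossing partition [P], use the pairs of gaps between consecutive *)
(* points that no chord of [P] separates, i.e. the Kreweras complement of [P];  *)
(* the strings [i, j) in the resulting thick subcategory are those with [i] and *)
(* [j] in the same part of [P].  Conversely, every representation is a direct   *)
(* sum of strings (an element generating a longest string splits off, by        *)
(* duality with its socle), so that a thick subcategory is determined by its    *)
(* strings, and the exact sequences                                             *)
(* [0 -> [i, i') -> [i, j') (+) [j, i') -> [j, j') -> 0] for i <= j <= i' <= j' *)
(* show that being the end points of a string of the subcategory is a           *)
(* noncrossing equivalence relation.  In the cyclic case this relation lives on *)
(* the universal cover and is [n]-periodic: as a string longer than [n] crosses *)
(* its translate by [n], the relation is determined by strings of length at     *)
(* most [n], and reducing it modulo [2n] loses nothing.                         *)

(** Both categories consist of the nilpotent representations of a quiver whose arrows lower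
    positions by one on a cover ([covering]), so one argument serves both halves. A thick
    subcategory is determined by its strings, because strings split off ([string_summand],
    [thick_le_string]), and two-of-three applied to [crossing_exact] makes membership of strings a
    noncrossing equivalence relation on end points ([linked_trans], [linked_crossing]).

    Conversely, a noncrossing partition is realised by a perpendicular category: [thick_perp] gives
    thickness, [string_walk_bij] decides which strings belong to it, and [same_gap_closed] says that
    the partition is recovered from its Kreweras complement. [thick_classification] turns these
    facts into an order isomorphism.

    For the cyclic quiver the relation lives on an infinite periodic cover. By [modulo_2nE] and
    [modulo_2n_sub] folding it onto 2n points loses nothing, and translation by n becomes the half
    turn [bar]. *)

Lemma linfunE (k : fieldType) (aT rT : vectType k) (f : aT -> rT) :
  linear f -> linfun f =1 f.
Proof.
move=> lin_f; pose F : {linear aT -> rT} :=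
  HB.pack f (GRing.isLinear.Build _ _ _ _ f lin_f).
exact: (lfunE F).
Qed.

Lemma lfun_fullP (k : fieldType) (aT rT : vectType k) (f : 'Hom(aT, rT)) :
  (forall y, exists x, f x = y) <-> limg f = fullv.
Proof.
split=> [sf|ff y].
  apply/eqP; rewrite eqEsubv subvf; apply/subvP=> y _.
  by have [x <-] := sf y; rewrite memv_img ?memvf.
have: y \in limg f by rewrite ff memvf.
by case/memv_imgP=> x _ ->; exists x.
Qed.

Lemma lfun_injP (k : fieldType) (aT rT : vectType k) (f : 'Hom(aT, rT)) :
  (forall x, f x = 0 -> x = 0) <-> lker f = 0%VS.
Proof.
split=> [inj_f|kf x fx].
  apply/eqP; rewrite -subv0; apply/subvP=> x.
  by rewrite memv_ker memv0 => /eqP/inj_f ->.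
by apply/eqP; rewrite -memv0 -kf memv_ker fx.
Qed.

(** * Action of paths as sums over walks *)

Section Walks.
Variables (k : fieldType) (Q : quiver).
Implicit Types (M N X Y Z : rep k Q) (u v w : vertex Q).

Lemma hom_actE M N (f : forall v, 'Hom(M v, N v)) : is_rep_hom f ->
  forall a x, rep_act N a (f (source a) x) = f (target a) (rep_act M a x).
Proof. by move=> hf a x; have /lfunP/(_ x) := hf a; rewrite !comp_lfunE. Qed.

Lemma is_rep_homP M N (f : forall v, 'Hom(M v, N v)) :
  (forall a x, rep_act N a (f (source a) x) = f (target a) (rep_act M a x)) ->
  is_rep_hom f.
Proof. by move=> hf a; apply/lfunP=> x; rewrite !comp_lfunE. Qed.

(** The walk of length 0: the cast along [v = u], extended by zero to distinct vertices so that sums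
    over all vertices make sense. *)
Definition transport M v u : 'Hom(M v, M u) :=
  match v =P u with
  | ReflectT e => eq_rect v (fun w => 'Hom(M v, M w)) \1%VF u e
  | ReflectF _ => 0
  end.

Lemma transport_id M v : transport M v v = \1%VF.
Proof.
rewrite /transport; case: eqP => // e.
by rewrite (eq_axiomK e).
Qed.

Lemma transport_neq M v u : v != u -> transport M v u = 0.
Proof. by rewrite /transport; case: eqP. Qed.

Definition step M v u : 'Hom(M v, M u) :=
  \sum_a (transport M (target a) u \o rep_act M a \o transport M v (source a))%VF.

(* The sum over all walks of length [l] from [v] to [u]; having both end points *)
(* as parameters avoids casts between the spaces at propositionally equal       *)
(* vertices.                                                                    *)
Fixpoint walk M l v u : 'Hom(M v, M u) :=
  if l is l'.+1 then \sum_w (step M w u \o walk M l' v w)%VF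
  else transport M v u.

Definition nilpotent M := exists l, forall v u, walk M l v u = 0.

Lemma walkSr M l v u x :
  walk M l.+1 v u x = \sum_w step M w u (walk M l v w x).
Proof. by rewrite /= sum_lfunE; apply: eq_bigr => w _; rewrite comp_lfunE. Qed.

Lemma walk0 M v x : walk M 0 v v x = x.
Proof. by rewrite /= transport_id id_lfunE. Qed.

Lemma walk0_neq M v u x : v != u -> walk M 0 v u x = 0.
Proof. by move=> vu /=; rewrite transport_neq // zero_lfunE. Qed.

Lemma walk1 M v u x : walk M 1 v u x = step M v u x.
Proof.
rewrite walkSr (bigD1 v) //= transport_id id_lfunE big1 ?addr0 // => w wv.
by rewrite transport_neq 1?eq_sym // zero_lfunE linear0.
Qed.

Lemma walkD M p q v u x :
  walk M (p + q) v u x = \sum_w walk M p w u (walk M q v w x).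
Proof.
elim: p u => [|p IHp] u.
  rewrite add0n (bigD1 u) //= transport_id id_lfunE big1 ?addr0 // => w wu.
  by rewrite transport_neq // zero_lfunE.
rewrite addSn walkSr; under eq_bigr do rewrite IHp linear_sum.
by rewrite exchange_big; apply: eq_bigr => w _; rewrite walkSr.
Qed.

Lemma walk_eq0D M l m : (forall v u, walk M l v u = 0) ->
  forall v u, walk M (m + l) v u = 0.
Proof.
move=> Ml v u; apply/lfunP=> x; rewrite walkD zero_lfunE big1 // => w _.
by rewrite Ml zero_lfunE linear0.
Qed.

Section Naturality.
Variables (M N : rep k Q) (f : forall v, 'Hom(M v, N v)).
Hypothesis hf : is_rep_hom f.

Lemma transport_nat v u x : f u (transport M v u x) = transport N v u (f v x).
Proof.
have [<-|vu] := eqVneq v u; first by rewrite !transport_id !id_lfunE.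
by rewrite !transport_neq // !zero_lfunE linear0.
Qed.

Lemma step_nat v u x : f u (step M v u x) = step N v u (f v x).
Proof.
rewrite /step !sum_lfunE linear_sum; apply: eq_bigr => a _.
by rewrite /= !comp_lfunE transport_nat -hom_actE // transport_nat.
Qed.

Lemma walk_nat l v u x : f u (walk M l v u x) = walk N l v u (f v x).
Proof.
elim: l u => [|l IHl] u; first exact: transport_nat.
by rewrite !walkSr linear_sum; apply: eq_bigr => w _; rewrite /= step_nat IHl.
Qed.

End Naturality.

Hypothesis arrow_inj : forall a b : arrow Q,
  source a = source b -> target a = target b -> a = b.

Lemma step_arrow M a : step M (source a) (target a) = rep_act M a.
Proof.
rewrite /step (bigD1 a) //= !transport_id comp_lfun1l comp_lfun1r.
rewrite big1 ?addr0 // => b ba.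
have [es|/transport_neq->] := eqVneq (source a) (source b); last by rewrite comp_lfun0r.
have [et|/transport_neq->] := eqVneq (target b) (target a); last by rewrite !comp_lfun0l.
by rewrite (arrow_inj es (esym et)) eqxx in ba.
Qed.

Lemma step_neq0 M v u x : step M v u x != 0 ->
  exists2 a : arrow Q, source a = v & target a = u.
Proof.
move=> nz; apply: contrapT => na; case/eqP: nz.
rewrite /step sum_lfunE big1 // => a _; rewrite !comp_lfunE.
have [es|/transport_neq->] := eqVneq v (source a); last by rewrite zero_lfunE !linear0.
have [et|/transport_neq->] := eqVneq (target a) u; last by rewrite zero_lfunE.
by case: na; exists a.
Qed.

End Walks.

Arguments walk : simpl never.

(** * Isomorphisms, exact sequences, sums and kernels, computed vertexwise *)

Section Constructions.
Variables (k : fieldType) (Q : quiver).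
Implicit Types (M N X Y Z : rep k Q) (u v w : vertex Q).

Lemma rep_iso_bij M N (f : forall v, 'Hom(M v, N v)) : is_rep_hom f ->
  (forall v x, f v x = 0 -> x = 0) -> (forall v y, exists x, f v x = y) ->
  rep_iso M N.
Proof.
move=> hf inj_f sur_f.
have kf v : lker (f v) == 0%VS by apply/eqP/lfun_injP/inj_f.
have fK v y : f v ((f v)^-1%VF y) = y.
  by apply: limg_lfunVK; have /lfun_fullP-> := sur_f v; rewrite memvf.
exists f, (fun v => (f v)^-1%VF); split=> //.
- apply: is_rep_homP => a x.
  by rewrite -[in RHS](fK _ x) hom_actE // lker0_lfunK.
- by move=> v; apply: lker0_compVf.
- by move=> v; apply/lfunP=> y; rewrite comp_lfunE id_lfunE fK.
Qed.

Lemma rep_iso_sym M N : rep_iso M N -> rep_iso N M.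
Proof. by move=> [f] [g] [hf hg fK gK]; exists g, f; split. Qed.

Lemma short_exactP X Y Z
    (f : forall v, 'Hom(X v, Y v)) (g : forall v, 'Hom(Y v, Z v)) :
  is_rep_hom f -> is_rep_hom g -> (forall v x, f v x = 0 -> x = 0) ->
  (forall v x, g v (f v x) = 0) ->
  (forall v y, g v y = 0 -> exists x, f v x = y) ->
  (forall v z, exists y, g v y = z) -> short_exact f g.
Proof.
move=> hf hg inj_f gf ker_g sur_g; split=> // v.
- exact/lfun_injP/inj_f.
- apply/vspaceP=> y; rewrite memv_ker; apply/memv_imgP/eqP.
    by case=> x _ ->; rewrite gf.
  by move/ker_g=> [x <-]; exists x; rewrite ?memvf.
- exact/lfun_fullP/sur_g.
Qed.

Lemma short_exact_elim X Y Z
    (f : forall v, 'Hom(X v, Y v)) (g : forall v, 'Hom(Y v, Z v)) :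
  short_exact f g ->
  [/\ forall v x, f v x = 0 -> x = 0, forall v x, g v (f v x) = 0,
      forall v y, g v y = 0 -> exists x, f v x = y &
      forall v z, exists y, g v y = z].
Proof.
move=> [_ _ kf ex cg]; split=> v.
- exact/lfun_injP.
- by move=> x; apply/eqP; rewrite -memv_ker -ex memv_img ?memvf.
- move=> y gy; have: y \in lker (g v) by rewrite memv_ker gy.
  by rewrite -ex => /memv_imgP[x _ ->]; exists x.
- exact/lfun_fullP.
Qed.

Lemma sum_actE M N a x :
  rep_act (rep_sum M N) a x = (rep_act M a x.1, rep_act N a x.2).
Proof. by rewrite /= linfunE // => c y z; rewrite !linearP. Qed.

Definition inl_hom M N v : 'Hom(M v, rep_sum M N v) := linfun (fun x => (x, 0)).
Definition inr_hom M N v : 'Hom(N v, rep_sum M N v) := linfun (fun x => (0, x)).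
Definition fst_hom M N v : 'Hom(rep_sum M N v, M v) := linfun (fun x => x.1).
Definition snd_hom M N v : 'Hom(rep_sum M N v, N v) := linfun (fun x => x.2).

Lemma inl_homE M N v x : inl_hom M N v x = (x, 0).
Proof.
by rewrite linfunE // => c y z; congr pair; rewrite /= scaler0 addr0.
Qed.
Lemma inr_homE M N v x : inr_hom M N v x = (0, x).
Proof.
by rewrite linfunE // => c y z; congr pair; rewrite /= scaler0 addr0.
Qed.
Lemma fst_homE M N v x : fst_hom M N v x = x.1. Proof. by rewrite linfunE. Qed.
Lemma snd_homE M N v x : snd_hom M N v x = x.2. Proof. by rewrite linfunE. Qed.

Lemma inl_hom_rep M N : is_rep_hom (inl_hom M N).
Proof. by apply: is_rep_homP => a x; rewrite !inl_homE sum_actE linear0. Qed.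
Lemma fst_hom_rep M N : is_rep_hom (fst_hom M N).
Proof. by apply: is_rep_homP => a x; rewrite !fst_homE sum_actE. Qed.
Lemma snd_hom_rep M N : is_rep_hom (snd_hom M N).
Proof. by apply: is_rep_homP => a x; rewrite !snd_homE sum_actE. Qed.

Lemma walk_sum M N l v u x :
  walk (rep_sum M N) l v u x = (walk M l v u x.1, walk N l v u x.2).
Proof.
rewrite [LHS]surjective_pairing -fst_homE -snd_homE.
rewrite (walk_nat (@fst_hom_rep M N)) (walk_nat (@snd_hom_rep M N)).
by rewrite fst_homE snd_homE.
Qed.

Lemma sum_short_exact M N : short_exact (inl_hom M N) (snd_hom M N).
Proof.
apply: short_exactP; [exact: inl_hom_rep | exact: snd_hom_rep | | | |] => v.
- by move=> x; rewrite inl_homE => -[].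
- by move=> x; rewrite inl_homE snd_homE.
- by move=> [x y]; rewrite snd_homE /= => ->; exists x; rewrite inl_homE.
- by move=> y; exists (0, y); rewrite snd_homE.
Qed.

Lemma nilpotent_sum M N : nilpotent M -> nilpotent N -> nilpotent (rep_sum M N).
Proof.
move=> [l Ml] [m Nm]; exists (m + l)%N => v u; apply/lfunP=> x.
rewrite walk_sum (walk_eq0D m Ml) addnC (walk_eq0D l Nm).
by rewrite !zero_lfunE.
Qed.

Lemma nilpotent_inj M N (f : forall v, 'Hom(M v, N v)) : is_rep_hom f ->
  (forall v x, f v x = 0 -> x = 0) -> nilpotent N -> nilpotent M.
Proof.
move=> hf inj_f [l Nl]; exists l => v u; apply/lfunP=> x.
by rewrite zero_lfunE; apply: inj_f; rewrite (walk_nat hf) Nl zero_lfunE.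
Qed.

Lemma nilpotent_iso M N : rep_iso M N -> nilpotent M -> nilpotent N.
Proof.
move=> [f] [g] [_ hg _ gK]; apply: nilpotent_inj hg _ => v x gx.
by rewrite -[x]id_lfunE -gK comp_lfunE gx linear0.
Qed.

Definition ker_rep M N (g : forall v, 'Hom(M v, N v)) (hg : is_rep_hom g) :=
  @Rep k Q (fun v => subvs_of (lker (g v)))
    (fun a => linfun (vsproj (lker (g (target a))) \o rep_act M a \o vsval)).

Definition ker_incl M N (g : forall v, 'Hom(M v, N v)) (hg : is_rep_hom g) v :
  'Hom(ker_rep hg v, M v) := linfun (@vsval k _ (lker (g v))).

Section Kernel.
Variables (M N : rep k Q) (g : forall v, 'Hom(M v, N v)) (hg : is_rep_hom g).

Lemma ker_inclE v x : ker_incl hg v x = vsval x.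
Proof. by rewrite lfunE. Qed.

Lemma ker_incl_inj v x : ker_incl hg v x = 0 -> x = 0.
Proof. by rewrite ker_inclE => x0; apply: val_inj. Qed.

Lemma ker_incl_rep : is_rep_hom (ker_incl hg).
Proof.
apply: is_rep_homP => a x; rewrite !ker_inclE lfunE /= vsprojK //.
by rewrite memv_ker -hom_actE //; have:= valP x; rewrite memv_ker => /eqP->; rewrite linear0.
Qed.

(* If [g \o f] is injective, then it is an automorphism of the finite           *)
(* dimensional [N], so that [f] splits off.                                     *)
Lemma rep_split (f : forall v, 'Hom(N v, M v)) : is_rep_hom f ->
  (forall v x, g v (f v x) = 0 -> x = 0) -> rep_iso M (rep_sum N (ker_rep hg)).
Proof.
move=> hf inj_gf; apply: rep_iso_sym.
pose h v : 'Hom(rep_sum N (ker_rep hg) v, M v) :=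
    ((f v \o fst_hom N (ker_rep hg) v)%VF + (ker_incl hg v \o snd_hom N (ker_rep hg) v)%VF).
have hE v x : h v x = f v x.1 + vsval x.2.
  by rewrite add_lfunE !comp_lfunE fst_homE snd_homE ker_inclE.
have gker v (y : ker_rep hg v) : g v (vsval y) = 0.
  by apply/eqP; rewrite -memv_ker; apply: valP.
have sur_gf v y : exists x, g v (f v x) = y.
  have : (limg (g v \o f v) = fullv)%VF.
    apply/eqP; rewrite eqEdim subvf limg_dim_eq ?leqnn //.
    rewrite capfv; apply/lfun_injP=> x; rewrite comp_lfunE; exact: inj_gf.
  by move/lfun_fullP/(_ y)=> [x <-]; exists x; rewrite comp_lfunE.
apply: (rep_iso_bij (f := h)).
- apply: is_rep_homP => a x; rewrite !hE sum_actE linearD -!ker_inclE.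
  by congr (_ + _); [exact: hom_actE | exact: (hom_actE ker_incl_rep)].
- move=> v [x y]; rewrite hE /= => xy0.
  have x0 : x = 0.
    by apply: inj_gf; rewrite -[LHS]addr0 -(gker v y) -linearD xy0 linear0.
  move: xy0; rewrite x0 linear0 add0r => y0; congr pair.
  exact: val_inj.
- move=> v y; have [x gfx] := sur_gf v (g v y).
  have ky : y - f v x \in lker (g v) by rewrite memv_ker linearB /= gfx subrr.
  by exists (x, vsproj _ (y - f v x)); rewrite hE /= vsprojK // addrC subrK.
Qed.

Lemma ker_dim v : (\dim {: ker_rep hg v} = \dim (lker (g v)))%N.
Proof. by rewrite dimvf /dim /=. Qed.

End Kernel.
End Constructions.

(** * Closure properties of thick subcategories; perpendicular categories *)

Section Thick.
Variables (k : fieldType) (Q : quiver) (A : rep k Q -> Prop).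
Hypothesis A_nilpotent : forall M, A M <-> nilpotent M.
Implicit Types (M N X Y Z : rep k Q).

Lemma ambient_sum M N : A M -> A N -> A (rep_sum M N).
Proof. by rewrite !A_nilpotent; apply: nilpotent_sum. Qed.

Section OneThick.
Variable C : rep k Q -> Prop.
Hypothesis thC : thick A C.

Let A_C M : C M -> A M. Proof. exact: thick_sub. Qed.

(** A zero object is the cokernel of the identity of any member, and [thick_nonempty] provides a
    member. *)
Lemma thick_zero Z : A Z -> (forall v (z : Z v), z = 0) -> C Z.
Proof.
move=> AZ Z0; have [M CM] := thick_nonempty thC.
have ex : @short_exact k Q M M Z (fun v => \1%VF) (fun v => 0).
  apply: short_exactP => [||v x|v x|v y _|v z].
  - by apply: is_rep_homP => a x; rewrite !id_lfunE.
  - by apply: is_rep_homP => a x; rewrite !zero_lfunE linear0.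
  - by rewrite id_lfunE.
  - by rewrite zero_lfunE.
  - by exists y; rewrite id_lfunE.
  - by exists 0; rewrite [z]Z0 linear0.
by case: (thick_2of3 thC (A_C CM) (A_C CM) AZ ex) => /(_ CM CM).
Qed.

Lemma thick_sum M N : C M -> C N -> C (rep_sum M N).
Proof.
move=> CM CN; have AM := A_C CM; have AN := A_C CN.
by have [_ h _] := thick_2of3 thC AM (ambient_sum AM AN) AN (sum_short_exact M N); apply: h.
Qed.

Lemma thick_suml M N : A M -> A N -> C (rep_sum M N) -> C M.
Proof.
move=> AM AN CMN; apply: (thick_summand thC AM AN CMN).
by exists (fun v => \1%VF), (fun v => \1%VF); split;
  try apply: is_rep_homP => a x; try move=> v; rewrite ?comp_lfun1l ?id_lfunE.
Qed.

Lemma thick_sumr M N : A M -> A N -> C (rep_sum M N) -> C N.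
Proof.
move=> AM AN CMN; have CM := thick_suml AM AN CMN.
by have [h _ _] := thick_2of3 thC AM (ambient_sum AM AN) AN (sum_short_exact M N); apply: h.
Qed.

(** An isomorphism [f] is a short exact sequence whose third term is a zero object, so two-of-three
    applies. The kernel of [f] serves as that zero object. *)
Lemma thick_iso M N : rep_iso M N -> A N -> C M -> C N.
Proof.
move=> [f] [g] [hf hg fK gK] AN CM.
have fgE v x : f v (g v x) = x by rewrite -comp_lfunE gK id_lfunE.
have gfE v x : g v (f v x) = x by rewrite -comp_lfunE fK id_lfunE.
have h0 X Y : @is_rep_hom k Q X Y (fun v => 0).
  by apply: is_rep_homP => a x; rewrite !zero_lfunE linear0.
pose Z := ker_rep (g := f) hf.
have Z0 v (z : Z v) : z = 0.
  apply: (@ker_incl_inj _ _ _ _ f hf); rewrite ker_inclE.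
  have /eqP fz : f v (vsval z) == 0 by rewrite -memv_ker; apply: valP.
  by rewrite -[LHS](gfE v) fz linear0.
have AZ : A Z.
  apply/A_nilpotent; apply: nilpotent_inj (ker_incl_rep hf) _ _.
    exact: ker_incl_inj.
  exact/A_nilpotent/A_C.
have ex : @short_exact k Q M N Z f (fun v => 0).
  apply: short_exactP => // v x.
  - by move=> fx; rewrite -[x]gfE fx linear0.
  - by rewrite zero_lfunE.
  - by exists (g v x).
  - by exists 0; rewrite [x]Z0 linear0.
have [_ h _] := thick_2of3 thC (A_C CM) AN AZ ex.
by apply: h => //; apply: thick_zero.
Qed.

End OneThick.

(* The class of [M] such that certain walks act bijectively is the perpendicular *)
(* category of a set of strings: the action of the walk from position [b - 1] to *)
(* position [a - 1] is obtained by applying [Hom(-, M)] to the projective        *)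
(* resolution of the string [a, ..., b - 1].                                     *)
Definition perp (I : nat -> vertex Q -> vertex Q -> Prop) M :=
  A M /\ forall d v u, I d v u ->
    (forall x, walk M d v u x = 0 -> x = 0) /\ (forall y, exists x, walk M d v u x = y).

(** By [walk_nat] a walk acts on a short exact sequence as a morphism of sequences, so bijectivity
    on two terms passes to the third by a diagram chase. On a direct sum it acts componentwise,
    which handles summands. *)
Lemma thick_perp I : (exists Z, A Z /\ forall v (z : Z v), z = 0) ->
  thick A (perp I).
Proof.
move=> [Z [AZ Z0]]; split.
- by move=> M [].
- exists Z; split=> // d v u _; split=> [x|y]; first by rewrite [x]Z0.
  by exists 0; rewrite [y]Z0 linear0.
- move=> M N X AM AN [AX PX] [f] [g] [hf hg fK gK]; split=> // d v u /PX[inj sur].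
  have fgE w x : f w (g w x) = x by rewrite -comp_lfunE gK id_lfunE.
  split=> [x x0|y].
    have gx0 : g v (x, 0) = 0.
      by apply: inj; rewrite -(walk_nat hg) walk_sum x0 !linear0.
    by have := fgE v (x, 0); rewrite gx0 linear0 => -[].
  have [x gx] := sur (g u (y, 0)); exists (f v x).1.
  by have := walk_nat hf d u x; rewrite gx fgE walk_sum => -[].
- move=> X Y Z' f g AX AY AZ' ex.
  have [hf hg _ _ _] := ex; have [inj_f gf ker_g sur_g] := short_exact_elim ex.
  have fW := walk_nat hf; have gW := walk_nat hg.
  split=> -[_ P1] [_ P2]; split=> // d v u Iduv;
    have [inj1 sur1] := P1 d v u Iduv; have [inj2 sur2] := P2 d v u Iduv.
  + split=> [z z0|z].
      have [y yz] := sur_g v z; have /ker_g[x fx] : g u (walk Y d v u y) = 0.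
        by rewrite gW yz.
      have [x' xx'] := sur1 x; have /eqP : y - f v x' = 0.
        by apply: inj2; rewrite linearB /= -fW xx' fx subrr.
      by rewrite subr_eq0 -yz => /eqP->; rewrite gf.
    have [y yz] := sur_g u z; have [y' yy'] := sur2 y.
    by exists (g v y'); rewrite -gW yy'.
  + split=> [y y0|y].
      have gy : g v y = 0 by apply: inj2; rewrite -gW y0 linear0.
      have [x fx] := ker_g _ _ gy.
      have x0 : x = 0 by apply: inj1; apply: inj_f; rewrite fW fx y0.
      by rewrite -fx x0 linear0.
    have [z zy] := sur2 (g u y); have [y' y'z] := sur_g v z.
    have /ker_g[x fx] : g u (y - walk Y d v u y') = 0.
      by rewrite linearB /= gW y'z zy subrr.
    have [x' xx'] := sur1 x; exists (y' + f v x').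
    by rewrite linearD /= -fW xx' fx addrC subrK.
  + split=> [x x0|x].
      by apply: inj_f; apply: inj1; rewrite -fW x0 linear0.
    have [y yx] := sur1 (f u x).
    have /ker_g[x' fx'] : g v y = 0 by apply: inj2; rewrite -gW yx gf.
    exists x'; have : walk X d v u x' - x = 0.
      by apply: inj_f; rewrite linearB /= fW fx' yx subrr.
    by move/eqP; rewrite subr_eq0 => /eqP.
Qed.

End Thick.

(* [pos t v] means that position [t] of the universal cover lies over the       *)
(* vertex [v]; arrows of the cover go from [t.+1] to [t].                       *)
Record covering (Q : quiver) (pos : nat -> vertex Q -> bool) : Prop := Covering {
  pos_uniq : forall t u v, pos t u -> pos t v -> u = v;
  pos_arrow : forall t a, pos t.+1 (source a) = pos t (target a);
  pos_source : forall t v, pos t.+1 v -> exists a : arrow Q, source a = v;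
  pos_ex : forall v, exists t, pos t v;
  source_inj : injective (@source Q)
}.

(** * String modules, their walks and the maps between them *)

Section Strings.
Variables (k : fieldType) (Q : quiver) (pos : nat -> vertex Q -> bool).
Hypothesis cov : covering pos.
Implicit Types (i j t s : nat) (u v w : vertex Q) (a : arrow Q).

Lemma arrow_inj a b : source a = source b -> target a = target b -> a = b.
Proof. by move/(source_inj cov). Qed.

Definition on_string i j t v := [&& i <= t, t < j & pos t v]%N.

Definition string_space i j v : vectType k :=
  {ffun {t : 'I_j | (i <= t)%N && pos t v} -> k^o}.

(** Coordinates indexed by all naturals and zero off the string, so that equations between them
    avoid the dependent index type. *)
Definition coeff i j v (x : string_space i j v) t : k :=
  \sum_s (x s : k) *+ (val (val s) == t).

Definition mk_string i j v (g : nat -> k) : string_space i j v :=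
  [ffun s => g (val (val s)) : k^o].

Lemma coeff_out i j v (x : string_space i j v) t :
  ~~ on_string i j t v -> coeff x t = 0.
Proof.
move=> nt; apply: big1 => -[[s sj] /= pr] _; case: eqP => // st.
by case/negP: nt; rewrite /on_string -st sj; case/andP: pr => -> ->.
Qed.

Lemma coeff_on i j v (x : string_space i j v) t :
  coeff x t != 0 -> on_string i j t v.
Proof. by apply: contraR => /coeff_out->. Qed.

Lemma coeff_val i j v (x : string_space i j v)
    (p : {t : 'I_j | (i <= t)%N && pos t v}) : coeff x (val (val p)) = x p.
Proof.
rewrite /coeff (bigD1 p) //= eqxx mulr1n big1 ?addr0 // => q qp.
by rewrite (inj_eq val_inj) (inj_eq val_inj) (negbTE qp).
Qed.

Lemma coeff_mk i j v g t :
  coeff (mk_string i j v g) t = if on_string i j t v then g t else 0.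
Proof.
case: ifPn => [/and3P[it tj tv]|/coeff_out//].
have pr : (i <= Ordinal tj)%N && pos (Ordinal tj) v by rewrite /= it.
by have := coeff_val (mk_string i j v g) (exist _ (Ordinal tj) pr); rewrite /= ffunE.
Qed.

Lemma coeff_inj i j v (x y : string_space i j v) : coeff x =1 coeff y -> x = y.
Proof. by move=> xy; apply/ffunP=> s; rewrite -!coeff_val xy. Qed.

Lemma coeffP i j v c (x y : string_space i j v) t :
  coeff (c *: x + y) t = c * coeff x t + coeff y t.
Proof.
rewrite /coeff mulr_sumr -big_split; apply: eq_bigr => s _.
by rewrite !ffunE /= mulrnDl mulrnAr.
Qed.

Lemma coeff0 i j v t : coeff (0 : string_space i j v) t = 0.
Proof. by apply: big1 => s _; rewrite ffunE mul0rn. Qed.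

Lemma coeffD i j v (x y : string_space i j v) t :
  coeff (x + y) t = coeff x t + coeff y t.
Proof. by rewrite -[x]scale1r coeffP mul1r scale1r. Qed.

Lemma coeffB i j v (x y : string_space i j v) t :
  coeff (x - y) t = coeff x t - coeff y t.
Proof. by rewrite -scaleN1r addrC coeffP mulN1r addrC. Qed.

Lemma coeff_sum i j v I (r : seq I) (F : I -> string_space i j v) t :
  coeff (\sum_(y <- r) F y) t = \sum_(y <- r) coeff (F y) t.
Proof.
elim: r => [|y r IHr]; first by rewrite !big_nil coeff0.
by rewrite !big_cons coeffD IHr.
Qed.

Definition reindex_string f i j v i' j' v' :
    'Hom(string_space i j v, string_space i' j' v') :=
  linfun (fun x => mk_string i' j' v' (fun t => coeff x (f t))).

Lemma coeff_reindex f i j v i' j' v' (x : string_space i j v) t :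
  coeff (reindex_string f i j v i' j' v' x) t =
    if on_string i' j' t v' then coeff x (f t) else 0.
Proof.
rewrite linfunE ?coeff_mk // => c y z; apply: coeff_inj => s.
by rewrite coeffP !coeff_mk; case: ifP => _; rewrite ?coeffP // mulr0 addr0.
Qed.

(* The string module with basis [e_i, ..., e_(j-1)], the arrows acting by       *)
(* [e_t |-> e_(t-1)].                                                           *)
Definition string_rep i j : rep k Q :=
  @Rep k Q (string_space i j)
    (fun a => reindex_string succn i j (source a) i j (target a)).

Lemma coeff_act i j a (x : string_rep i j (source a)) t :
  coeff (rep_act (string_rep i j) a x) t =
    if on_string i j t (target a) then coeff x t.+1 else 0.
Proof. exact: coeff_reindex. Qed.

Lemma coeff_step i j v u (x : string_rep i j v) t :
  coeff (step (string_rep i j) v u x) t = if on_string i j t u then coeff x t.+1 else 0.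
Proof.
have [[a [sa ta]]|na] := lem (exists a, source a = v /\ target a = u).
  by subst v u; rewrite (step_arrow arrow_inj) coeff_act.
have -> : step (string_rep i j) v u x = 0.
  apply/eqP/negPn/negP => /step_neq0[a sa ta].
  by apply: na; exists a.
rewrite coeff0; case: ifPn => // /and3P[_ _ tu]; apply/esym/eqP/negPn/negP.
move/coeff_on => /and3P[_ _ tv]; have [a sa] := pos_source cov tv.
apply: na; exists a; split=> //; apply: (pos_uniq cov _ tu).
by rewrite -(pos_arrow cov) sa.
Qed.

Lemma coeff_walk i j d v u (x : string_rep i j v) t :
  coeff (walk (string_rep i j) d v u x) t =
    if on_string i j t u then coeff x (t + d)%N else 0.
Proof.
elim: d u t => [|d IHd] u t.
  rewrite addn0; have [<-|vu] := eqVneq v u.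
    by rewrite walk0; case: ifPn => // /coeff_out.
  rewrite walk0_neq // coeff0; case: ifPn => // /and3P[_ _ tu].
  apply/esym/eqP/negPn/negP => /coeff_on/and3P[_ _ tv].
  by rewrite (pos_uniq cov tv tu) eqxx in vu.
rewrite walkSr coeff_sum; under eq_bigr do rewrite coeff_step IHd addSnnS.
case: ifPn => [/and3P[it _ _]|_]; last by rewrite big1.
have [->|nz] := eqVneq (coeff x (t + d.+1)%N) 0.
  by apply: big1 => w _; case: ifP.
have /and3P[_ tj tv] := coeff_on nz.
(* The walk passes over position [t.+1]: arrows lead down from position [t + d.+1], which lies over
   [v]. This vertex gives the only nonzero summand. *)
have [w tw] : exists w, pos t.+1 w.
  clear IHd nz tj; elim: d v x tv => [|d IHd] v x tv; first by exists v; rewrite -addn1.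
  rewrite addnS in tv; have [a sa] := pos_source cov tv.
  by apply: (IHd (target a) 0); rewrite -(pos_arrow cov) sa.
have jw : on_string i j t.+1 w by rewrite /on_string tw; lia.
rewrite (bigD1 w) //= jw big1 ?addr0 // => w' w'w; case: ifPn => // /and3P[_ _ tw'].
by rewrite (pos_uniq cov tw' tw) eqxx in w'w.
Qed.

Lemma nilpotent_string i j : nilpotent (string_rep i j).
Proof.
exists j => v u; apply/lfunP=> x; apply: coeff_inj => t.
rewrite coeff_walk zero_lfunE coeff0; case: ifP => // _.
by apply: coeff_out; rewrite /on_string; lia.
Qed.

Lemma string_rep0 i j v (x : string_rep i j v) : (j <= i)%N -> x = 0.
Proof.
move=> ji; apply: coeff_inj => t; rewrite coeff0 coeff_out // /on_string.
by lia.
Qed.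

(** The walk sends e_(t+d) to e_t, so it is bijective exactly when the shift by [d] matches the
    positions over [v] with those over [u]. Surjectivity is tested on the all-ones vector,
    injectivity on basis vectors. *)
Lemma string_walk_bij i j d v u :
  ((forall x, walk (string_rep i j) d v u x = 0 -> x = 0) /\
   (forall y, exists x, walk (string_rep i j) d v u x = y)) <->
  (forall t, on_string i j t u -> on_string i j (t + d) v) /\
  (forall t, on_string i j t v -> (d <= t)%N && on_string i j (t - d) u).
Proof.
split=> -[H1 H2]; split.
- move=> t tu; have [x xt] := H2 (mk_string i j u (fun=> 1)).
  have := congr1 (fun z => coeff z t) xt; rewrite coeff_walk coeff_mk tu => cx.
  by apply: (@coeff_on _ _ _ x); rewrite cx oner_neq0.
- move=> t tv; apply: contraT => nt.
  have /H1 : walk (string_rep i j) d v u (mk_string i j v (fun s => (s == t)%:R)) = 0.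
    apply: coeff_inj => s; rewrite coeff_walk coeff0 coeff_mk.
    case: ifP => // su; case: ifP => // _; case: eqP => // sdt.
    by case/negP: nt; rewrite -sdt leq_addl addnK.
  by move/(congr1 (fun z => coeff z t)); rewrite coeff_mk tv eqxx coeff0 => /eqP; rewrite oner_eq0.
- move=> x x0; apply: coeff_inj => t; rewrite coeff0.
  have [//|/coeff_on/H2/andP[dt tu]] := eqVneq (coeff x t) 0.
  have := congr1 (fun z => coeff z (t - d)%N) x0.
  by rewrite coeff_walk tu subnK // coeff0.
- move=> y; exists (mk_string i j v (fun t => coeff y (t - d)%N)).
  apply: coeff_inj => t; rewrite coeff_walk coeff_mk addnK.
  by case: ifPn => [/H1->//|/coeff_out->].
Qed.

(** For [i <= i'] and [j <= j'] this is the projection onto the quotient [i', j) followed by its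
    inclusion into [i', j'): arrows lower positions, so initial segments are submodules. *)
Definition string_map i j i' j' v : 'Hom(string_rep i j v, string_rep i' j' v) :=
  reindex_string id i j v i' j' v.

Lemma coeff_map i j i' j' v (x : string_rep i j v) t :
  coeff (string_map i j i' j' v x) t = if on_string i' j' t v then coeff x t else 0.
Proof. exact: coeff_reindex. Qed.

Lemma string_map_rep i j i' j' : (i <= i')%N -> (j <= j')%N ->
  is_rep_hom (string_map i j i' j').
Proof.
move=> ii' jj'; apply: is_rep_homP => a x; apply: coeff_inj => t.
rewrite coeff_act !coeff_map coeff_act; case: ifPn => // /and3P[i't tj' ta].
have sa : pos t.+1 (source a) by rewrite (pos_arrow cov).
have [->|/coeff_on/and3P[it tj _]] := eqVneq (coeff x t.+1) 0; first by do 2!case: ifP.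
by rewrite /on_string ta sa !ifT //; lia.
Qed.

Lemma string_map_iso i j i' j' : (i <= i')%N -> (j <= j')%N ->
  (forall t v, on_string i j t v = on_string i' j' t v) ->
  rep_iso (string_rep i j) (string_rep i' j').
Proof.
move=> ii' jj' same; apply: (rep_iso_bij (string_map_rep ii' jj')) => [v x fx|v y].
  apply: coeff_inj => t; rewrite coeff0.
  have := congr1 (fun z => coeff z t) fx; rewrite coeff_map coeff0 -same.
  by case: ifPn => // /coeff_out->.
exists (string_map i' j' i j v y); apply: coeff_inj => t.
by rewrite !coeff_map same; case: (boolP (on_string i' j' t v)) => // /coeff_out->.
Qed.

Lemma string_shift n i j : (forall t v, pos (t + n) v = pos t v) ->
  rep_iso (string_rep i j) (string_rep (i + n) (j + n)).
Proof.
move=> pern.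
have on_shift t v : (n <= t)%N -> on_string (i + n) (j + n) t v = on_string i j (t - n) v.
  by move=> nt; rewrite /on_string -{3}(subnK nt) pern; lia.
have low t v : (t < n)%N -> on_string (i + n) (j + n) t v = false.
  by move=> tn; rewrite /on_string; lia.
pose f v : 'Hom(string_rep i j v, string_rep (i + n) (j + n) v) :=
  reindex_string (subn^~ n) i j v (i + n) (j + n) v.
apply: (rep_iso_bij (f := f)) => [|v x fx|v y].
- apply: is_rep_homP => a x; apply: coeff_inj => t.
  rewrite coeff_act !coeff_reindex; case: ifP => // ont; have nt : (n <= t)%N.
    by rewrite leqNgt; apply: contraL ont => /low->.
  have e : (t.+1 - n = (t - n).+1)%N by lia.
  rewrite e -on_shift // ont; case: ifPn => //; rewrite on_shift ?e; last by lia.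
  by move/coeff_out->.
- apply: coeff_inj => t; have := congr1 (fun z => coeff z (t + n)%N) fx.
  rewrite coeff_reindex !coeff0 on_shift ?leq_addl // addnK.
  by case: ifPn => // /coeff_out->.
- exists (reindex_string (addn^~ n) _ _ v _ _ v y); apply: coeff_inj => t.
  rewrite !coeff_reindex; case: ifPn => [ont|/coeff_out->//]; have nt : (n <= t)%N.
    by rewrite leqNgt; apply: contraL ont => /low->.
  by rewrite -on_shift // ont subnK.
Qed.

Definition crossing_inj i j i' j' v :
    'Hom(string_rep i i' v, rep_sum (string_rep i j') (string_rep j i') v) :=
  (inl_hom _ _ v \o string_map i i' i j' v)%VF +
  (inr_hom _ _ v \o string_map i i' j i' v)%VF.

Definition crossing_sur i j i' j' v :
    'Hom(rep_sum (string_rep i j') (string_rep j i') v, string_rep j j' v) :=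
  (string_map i j' j j' v \o fst_hom _ _ v)%VF -
  (string_map j i' j j' v \o snd_hom _ _ v)%VF.

(* For [j = i'] this is the extension of the string [i', j') by [i, i'); for    *)
(* [j < i'] it is the reason why thick subcategories give noncrossing           *)
(* partitions.                                                                  *)
Lemma crossing_exact i j i' j' : (i <= j <= i')%N -> (i' <= j')%N ->
  short_exact (crossing_inj i j i' j') (crossing_sur i j i' j').
Proof.
move=> /andP[ij ji'] i'j'.
have fE v x : crossing_inj i j i' j' v x =
    (string_map i i' i j' v x, string_map i i' j i' v x).
  rewrite add_lfunE !comp_lfunE inl_homE inr_homE.
  by congr pair; rewrite /= ?addr0 ?add0r.
have gE v y : crossing_sur i j i' j' v y =
    string_map i j' j j' v y.1 - string_map j i' j j' v y.2.
  by rewrite add_lfunE opp_lfunE !comp_lfunE fst_homE snd_homE.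
apply: short_exactP.
- apply: is_rep_homP => a x; rewrite !fE sum_actE.
  by rewrite !(hom_actE (string_map_rep _ _)).
- apply: is_rep_homP => a x; rewrite !gE sum_actE linearB.
  by congr (_ - _); apply: hom_actE; apply: string_map_rep; lia.
- move=> v x; rewrite fE => -[/(congr1 (fun z => coeff z)) cx _]; apply: coeff_inj => t.
  have := congr1 (@^~ t) cx; rewrite coeff_map !coeff0.
  have [->//|/coeff_on/and3P[it ti' tv]] := eqVneq (coeff x t) 0.
  by rewrite /on_string tv ifT //; lia.
- move=> v x; rewrite fE gE; apply: coeff_inj => t.
  rewrite coeffB !coeff_map coeff0; case: ifPn => [/and3P[jt tj' tv]|_]; last by rewrite subr0.
  rewrite /on_string tv jt tj' !andbT /= ifT; last by lia.
  case: ltnP => [_|i't]; first by rewrite subrr.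
  by rewrite coeff_out ?subr0 // /on_string; lia.
- move=> v [y z]; rewrite gE /= => yz.
  have yz_t t : on_string j j' t v -> coeff y t = coeff z t.
    move=> ont; have := congr1 (fun z => coeff z t) yz.
    by rewrite coeffB !coeff_map coeff0 ont => /eqP; rewrite subr_eq0 => /eqP.
  exists (string_map i j' i i' v y); rewrite fE; congr pair; apply: coeff_inj => t.
    rewrite !coeff_map; have [y0|nz] := eqVneq (coeff y t) 0.
      by rewrite y0; case: ifP => _ //; case: ifP.
    have := coeff_on nz; rewrite /on_string => /and3P[it tj' tv].
    rewrite it tj' tv /= ?andbT; case: ltnP => // i't.
    have ont : on_string j j' t v by rewrite /on_string tv tj'; lia.
    by rewrite yz_t // coeff_out // /on_string; lia.
  rewrite !coeff_map; case: ifPn => [/and3P[jt ti' tv]|/coeff_out->//].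
  by rewrite /on_string ti' tv ifT ?yz_t // /on_string ?tv; lia.
- move=> v w; exists (string_map j j' i j' v w, 0); rewrite gE /= linear0 subr0.
  apply: coeff_inj => t; rewrite !coeff_map; case: ifPn => [/and3P[jt tj' tv]|/coeff_out->//].
  by rewrite /on_string tv tj' ifT //; lia.
Qed.

(** Common shape of [interval_rep] and [uniserial_rep]. *)
Definition thin_rep (b : vertex Q -> bool) (c : arrow Q -> k) : rep k Q :=
  @Rep k Q (fun v => 'rV[k]_(b v)) (fun a => linfun (mulmxr (const_mx (c a)))).

(** Each vertex carries at most one basis vector of the string, so summing all coefficients reads
    off the only coordinate without choosing its position. *)
Lemma thin_rep_iso i j (b : vertex Q -> bool) (c : arrow Q -> k) :
  (forall v, b v <-> exists t, on_string i j t v) ->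
  (forall t s v, on_string i j t v -> on_string i j s v -> t = s) ->
  (forall a t s, on_string i j t (source a) -> on_string i j s (target a) ->
     c a = (t == s.+1)%:R) ->
  rep_iso (string_rep i j) (thin_rep b c).
Proof.
move=> bP uni cP.
have coeff_sum_at v (x : string_rep i j v) t : on_string i j t v ->
    \sum_(s < j) coeff x s = coeff x t.
  move=> tv; have /and3P[_ tj _] := tv.
  rewrite (bigD1 (Ordinal tj)) //= big1 ?addr0 // => s st.
  apply: contraNeq st => /coeff_on sv; apply/eqP/val_inj => /=.
  exact: uni sv tv.
have ord_b v (y z : 'I_(b v)) : y = z.
  by apply/val_inj; case: (b v) y z => -[[|m] ?] [[|p] ?].
pose f v : 'Hom(string_rep i j v, thin_rep b c v) :=
  linfun (fun x => const_mx (\sum_(s < j) coeff x s)).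
have fE v x y : f v x 0 y = \sum_(s < j) coeff x s.
  rewrite linfunE ?mxE // => e x1 x2; apply/rowP=> y'; rewrite !mxE mulr_sumr -big_split.
  by apply: eq_bigr => s _; rewrite coeffP.
have by_ v (y : 'I_(b v)) : exists t, on_string i j t v.
  by apply/bP; case: (b v) y => // -[].
apply: (rep_iso_bij (f := f)).
- apply: is_rep_homP => a x; apply/rowP=> y; rewrite lfunE /= fE mxE.
  have [s sa] := by_ _ y; rewrite (coeff_sum_at _ _ s) // coeff_act sa.
  under eq_bigr do rewrite mxE fE.
  have [bs|nb] := boolP (b (source a)).
    have [t ta] := (bP _).1 bs.
    rewrite big_ord1 (coeff_sum_at _ _ t) // (cP a t s) //.
    have [->|ts] := eqVneq t s.+1; first by rewrite mulr1.
    rewrite mulr0; apply/esym/eqP; apply: contraNT ts => /coeff_on sta.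
    by apply/eqP; apply: uni sta.
  rewrite big_ord0.
  by apply/esym/eqP; apply: contraNT nb => /coeff_on sta; apply/bP; exists s.+1.
- move=> v x fx; apply: coeff_inj => t; rewrite coeff0.
  apply/eqP; apply: contraT => nz; have tv := coeff_on nz.
  have bv : b v by apply/bP; exists t.
  have z : 'I_(b v) by rewrite bv; exact: ord0.
  by case/eqP: nz; rewrite -(coeff_sum_at _ _ _ tv) -(fE _ _ z) fx mxE.
- move=> v r; exists (mk_string i j v (fun=> \sum_y r 0 y)); apply/rowP=> y.
  have [t tv] := by_ _ y; rewrite fE (coeff_sum_at _ _ _ tv) coeff_mk tv.
  by rewrite (bigD1 y) //= big1 ?addr0 // => z /eqP[]; apply: ord_b.
Qed.

End Strings.

(** * Every nilpotent representation is a direct sum of strings *)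

Section Decomposition.
Variables (k : fieldType) (Q : quiver) (pos : nat -> vertex Q -> bool).
Hypothesis cov : covering pos.
Implicit Types (M N : rep k Q) (u v w : vertex Q).

(** Both sources lie over the position just above a position of the common target. *)
Lemma target_inj (a b : arrow Q) : target a = target b -> a = b.
Proof.
move=> tab; have [t ta] := pos_ex cov (target a).
apply: (source_inj cov); apply: (@pos_uniq _ _ cov t.+1); rewrite (pos_arrow cov) //.
by rewrite -tab.
Qed.

Lemma walk_act M q v (a : arrow Q) x :
  rep_act M a (walk M q v (source a) x) = walk M q.+1 v (target a) x.
Proof.
rewrite walkSr (bigD1 (source a)) //= (step_arrow (arrow_inj cov)).
rewrite big1 ?addr0 // => w wa; apply/eqP; apply: contraNT wa => /step_neq0[b <-].
by move/target_inj->.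
Qed.

Lemma walk_actr M l u (a : arrow Q) x :
  walk M l (target a) u (rep_act M a x) = walk M l.+1 (source a) u x.
Proof.
rewrite -addn1 walkD (bigD1 (target a)) // big1 => [|w wa].
  by rewrite walk1 (step_arrow (arrow_inj cov)); apply/esym/addr0.
suff -> : walk M 1 (source a) w x = 0 by rewrite linear0.
apply/eqP; apply: contraNT wa; rewrite walk1 => /step_neq0[b] /(source_inj cov)->.
by move->.
Qed.

Lemma walk_pos_source M l v u x t : walk M l v u x != 0 -> pos t u -> pos (t + l) v.
Proof.
elim: l t u => [|l IHl] t u nz tu.
  have [->|vu] := eqVneq v u; first by rewrite addn0.
  by rewrite walk0_neq ?eqxx in nz.
have [w snz] : exists w, step M w u (walk M l v w x) != 0.
  apply: contrapT => none; case/eqP: nz; rewrite walkSr big1 // => w _.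
  by apply/eqP/negPn/negP => nz; apply: none; exists w.
have [a aw au] := step_neq0 snz; rewrite -addSnnS; apply: (IHl _ w).
  by apply: contraNneq snz => ->; rewrite linear0.
by rewrite -aw (pos_arrow cov) au.
Qed.

Lemma walk_pos_target M l v u x t : walk M l v u x != 0 -> pos (t + l) v -> pos t u.
Proof.
elim: l t u => [|l IHl] t u nz tv.
  have [<-|vu] := eqVneq v u; first by rewrite -(addn0 t).
  by rewrite walk0_neq ?eqxx in nz.
have [w snz] : exists w, step M w u (walk M l v w x) != 0.
  apply: contrapT => none; case/eqP: nz; rewrite walkSr big1 // => w _.
  by apply/eqP/negPn/negP => nz; apply: none; exists w.
have [a aw au] := step_neq0 snz; rewrite -au -(pos_arrow cov) aw.
apply: IHl; last by rewrite addSnnS.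
by apply: contraNneq snz => ->; rewrite linear0.
Qed.

Lemma walk_comp M p q v u w t x : pos t w -> pos (t + q) v ->
  walk M p w u (walk M q v w x) = walk M (p + q) v u x.
Proof.
move=> tw tv; rewrite walkD (bigD1 w) //= big1 ?addr0 // => w' w'w.
suff -> : walk M q v w' x = 0 by rewrite linear0.
apply/eqP; apply: contraNT w'w => /walk_pos_target/(_ tv) tw'.
by rewrite (pos_uniq cov tw' tw).
Qed.

Lemma dual_vector (V : vectType k) (y : V) : y != 0 ->
  exists phi : 'Hom(V, k^o), phi y = 1.
Proof.
move=> y0; pose B := vbasis (fullv : {vspace V}).
have [i iy] : exists i, coord B i y != 0.
  apply: contrapT => none; case/eqP: y0; rewrite (coord_vbasis (memvf y)).
  apply: big1 => i _; have [->|nz] := eqVneq (coord B i y) 0; first by rewrite scale0r.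
  by case: none; exists i.
exists (linfun (fun z : V => (coord B i z / coord B i y : k^o))).
rewrite linfunE ?divff // => e z1 z2.
by rewrite linearP mulrDl -mulrA.
Qed.

Definition total_dim M := (\sum_v \dim {: M v})%N.

Section Splitting.
Variables (M : rep k Q) (L i : nat) (u v : vertex Q) (x : M v).
Variable phi : 'Hom(M u, k^o).
Hypotheses (walk_max : forall w w' y, walk M L.+1 w w' y = 0)
  (iu : pos i u) (iLv : pos (i + L) v) (phi1 : phi (walk M L v u x) = 1).

Let j := (i + L).+1.

Let walk_gt l w w' y : (L < l)%N -> walk M l w w' y = 0.
Proof.
move/subnK<-; rewrite (walk_eq0D _ (l := L.+1)) ?zero_lfunE // => a b.
by apply/lfunP=> z; rewrite walk_max zero_lfunE.
Qed.

(** e_s goes to the image of [x] under the walk from position [i + L] down to [s]; the image is the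
    submodule generated by [x]. *)
Definition socle_incl w : 'Hom(string_rep k pos i j w, M w) :=
  linfun (fun c => \sum_(s < j) coeff c s *: walk M (i + L - s) v w x).

(** Dual to [socle_incl]: the coordinate at position [s] is [phi] pulled back along the walk from
    [s] down to the socle position [i]. *)
Definition socle_coord w : 'Hom(M w, string_rep k pos i j w) :=
  linfun (fun m => mk_string pos i j w (fun s => phi (walk M (s - i) w u m))).

Let inclE w c : socle_incl w c = \sum_(s < j) coeff c s *: walk M (i + L - s) v w x.
Proof.
rewrite linfunE // => e c1 c2; rewrite scaler_sumr -big_split.
by apply: eq_bigr => s _; rewrite coeffP scalerDl scalerA.
Qed.

Let coordE w m t : coeff (socle_coord w m) t =
  if on_string pos i j t w then phi (walk M (t - i) w u m) else 0.
Proof.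
rewrite linfunE ?coeff_mk // => e m1 m2; apply: coeff_inj => s.
by rewrite coeffP !coeff_mk; case: ifP => _; rewrite ?linearP // mulr0 addr0.
Qed.

Lemma socle_incl_rep : is_rep_hom socle_incl.
Proof.
apply: is_rep_homP => a c; rewrite !inclE linear_sum.
(* On the left the term at position 0 dies, its walk becoming longer than [L]; on the right the
   coordinate at the top position [i + L] vanishes. The remaining terms match after an index
   shift. *)
rewrite big_ord_recl big_ord_recr /=.
rewrite linearZ /= walk_act walk_gt ?scaler0 ?add0r; last by lia.
have -> : coeff (rep_act (string_rep k pos i j) a c) (i + L)%N = 0.
  rewrite coeff_act; case: ifP => // _; apply: coeff_out; rewrite /on_string /j.
  by lia.
rewrite scale0r addr0; apply: eq_bigr => s _; rewrite linearZ /= walk_act coeff_act.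
rewrite /bump /= add1n; have -> : (i + L - s.+1).+1 = (i + L - s)%N by case: s => s /=; lia.
case: ifPn => // nos; have [->|/coeff_on/and3P[is_ sj sa]] := eqVneq (coeff c s.+1) 0.
  by rewrite scale0r.
rewrite scale0r walk_gt ?scaler0 //; move: nos; rewrite /on_string -(pos_arrow cov) sa.
by case: s {is_ sj sa} => s sj /=; rewrite /j; lia.
Qed.

Lemma socle_coord_rep : is_rep_hom socle_coord.
Proof.
apply: is_rep_homP => a m; apply: coeff_inj => t; rewrite coeff_act !coordE.
case: ifPn => // /and3P[it tj ta]; rewrite walk_actr -subSn //.
case: ifPn => //; rewrite /on_string (pos_arrow cov) ta /j => nt.
by rewrite walk_gt ?linear0 //; move: tj; rewrite /j; lia.
Qed.

(** The composite is unitriangular: the contribution of e_s to coordinate [t] comes from a walk of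
    length L + t - s, which vanishes for s < t and gives 1 for s = t. Hence the induction downwards
    from the top position. *)
Lemma socle_split w c : socle_coord w (socle_incl w c) = 0 -> c = 0.
Proof.
move=> gf0; suff down d t : (j <= t + d)%N -> coeff c t = 0.
  by apply: coeff_inj => t; rewrite coeff0 (down j) ?leq_addl.
elim: d t => [|d IHd] t jt.
  by apply: coeff_out; rewrite /on_string; lia.
apply/eqP; apply: contraT => nz; have tw := coeff_on nz.
have /and3P[it tj pt] := tw.
have := congr1 (fun z => coeff z t) gf0; rewrite coordE tw coeff0 inclE !linear_sum.
rewrite (bigD1 (Ordinal tj)) //= big1 => [|s st].
  rewrite addr0 !linearZ /= (@walk_comp _ _ _ _ _ _ t) //; last first.
    by rewrite subnKC //; move: tj; rewrite /j.
  have -> : (t - i + (i + L - t) = L)%N by move: tj; rewrite /j; lia.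
  by rewrite phi1 => /eqP; rewrite /GRing.scale /= mulr1 (negbTE nz).
have [->|nzs] := eqVneq (coeff c s) 0; first by rewrite scale0r !linear0.
have [ts|st'] := ltnP t s.
  by case/eqP: nzs; apply: IHd; lia.
have /and3P[is_ sj ps] := coeff_on nzs.
rewrite !linearZ /= (@walk_comp _ _ _ _ _ _ s) //; last by rewrite subnKC //; move: sj; rewrite /j.
rewrite walk_gt ?linear0 ?scaler0 //.
have st2 : (s < t)%N.
  by rewrite ltn_neqAle st' andbT; apply: contraNneq st => st; apply/eqP/val_inj.
by move: (nat_of_ord s) sj is_ st2; rewrite /j; lia.
Qed.

Lemma string_splits : rep_iso M (rep_sum (string_rep k pos i j) (ker_rep socle_coord_rep)).
Proof. exact: rep_split socle_incl_rep socle_split. Qed.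

Lemma total_dim_ker : (total_dim (ker_rep socle_coord_rep) < total_dim M)%N.
Proof.
have le w : (\dim {: ker_rep socle_coord_rep w} <= \dim {: M w})%N.
  by rewrite ker_dim dimvS ?subvf.
have lt_u : (\dim {: ker_rep socle_coord_rep u} < \dim {: M u})%N.
  rewrite ltn_neqAle; apply/andP; split; last exact: le.
  rewrite ker_dim; apply/eqP=> dim_eq; have : lker (socle_coord u) = fullv.
    by apply/eqP; rewrite eqEdim subvf dim_eq leqnn.
  move/vspaceP/(_ (walk M L v u x)); rewrite memvf memv_ker => /eqP.
  move/(congr1 (fun z => coeff z i)); rewrite coordE coeff0 subnn walk0 phi1.
  rewrite /on_string iu leqnn /j ltnS leq_addr /= => /eqP.
  by rewrite oner_eq0.
rewrite /total_dim (bigD1 u) //= [ltnRHS](bigD1 u) //= -addSn leq_add //.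
by apply: leq_sum => w _; apply: le.
Qed.

End Splitting.

(** Nilpotency bounds the length of nonzero walks, so a longest one exists; its maximality makes
    both comparison maps with the string morphisms. *)
Lemma string_summand M : nilpotent M -> (exists v (x : M v), x != 0) ->
  exists i j N, [/\ rep_iso M (rep_sum (string_rep k pos i j) N), nilpotent N &
                    (total_dim N < total_dim M)%N].
Proof.
move=> nilM [v0 [x0 x0nz]].
pose P l := `[< exists v u (x : M v), walk M l v u x != 0 >].
have exP : exists l, P l.
  by exists 0%N; apply/asboolP; exists v0, v0, x0; rewrite walk0.
have [l0 Ml0] := nilM.
have ubP l : P l -> (l <= l0)%N.
  move=> /asboolP[v [u [x]]]; apply: contraNT; rewrite -ltnNge => /ltnW/subnK<-.
  by rewrite (walk_eq0D _ Ml0) zero_lfunE.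
case: (ex_maxnP exP ubP) => L /asboolP[v [u [x nz]]] maxL.
have walk_max w w' y : walk M L.+1 w w' y = 0.
  apply/eqP; apply: contraT => nz'; have /maxL : P L.+1 by apply/asboolP; exists w, w', y.
  by rewrite ltnn.
have [i iu] := pos_ex cov u; have iLv := walk_pos_source nz iu.
have [phi phi1] := dual_vector nz.
exists i, (i + L).+1, (ker_rep (socle_coord_rep phi walk_max iu iLv)); split.
- exact: string_splits phi1.
- exact: nilpotent_inj (ker_incl_rep _) (@ker_incl_inj _ _ _ _ _ _) nilM.
- exact: total_dim_ker phi1.
Qed.

End Decomposition.

(** * The end point relation of a thick subcategory *)

Section ThickStrings.
Variables (k : fieldType) (Q : quiver) (pos : nat -> vertex Q -> bool).
Hypothesis cov : covering pos.
Variable A : rep k Q -> Prop.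
Hypothesis A_nilpotent : forall M, A M <-> nilpotent M.
Notation string := (string_rep k pos).

Lemma ambient_string i j : A (string i j).
Proof. by apply/A_nilpotent; apply: nilpotent_string. Qed.

(** Induction on total dimension: split off a string and use closure under sums and summands. *)
Lemma thick_le_string (C D : rep k Q -> Prop) : thick A C -> thick A D ->
  (forall i j, C (string i j) -> D (string i j)) -> forall M, C M -> D M.
Proof.
move=> thC thD CD M; have [m] := ubnP (total_dim M).
elim: m M => // m IHm M dimM CM; have AM := thick_sub thC CM.
have [nz|allz] := lem (exists v (x : M v), x != 0); last first.
  apply: (thick_zero thD) => // v z; apply/eqP/negPn/negP => znz.
  by apply: allz; exists v, z.
have [i [j [N [isoM /A_nilpotent AN dimN]]]] := string_summand cov ((A_nilpotent M).1 AM) nz.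
have CS : C (rep_sum (string i j) N).
  by apply: (thick_iso A_nilpotent thC isoM) => //; apply: ambient_sum => //; apply: ambient_string.
apply: (thick_iso A_nilpotent thD (rep_iso_sym isoM)) => //.
apply: (thick_sum A_nilpotent thD).
  by apply/CD/(thick_suml thC _ AN CS); apply: ambient_string.
apply: IHm; first by move: dimM dimN; lia.
exact: (thick_sumr A_nilpotent thC (ambient_string i j) AN CS).
Qed.

Section OneThickStrings.
Variable C : rep k Q -> Prop.
Hypothesis thC : thick A C.

Lemma thick_string_nil i j : (j <= i)%N -> C (string i j).
Proof.
move=> ji; apply: (thick_zero thC); first exact: ambient_string.
by move=> v z; apply: string_rep0.
Qed.

Lemma thick_crossing i j i' j' : (i <= j <= i')%N -> (i' <= j')%N ->
  [/\ C (string i i') -> C (string j j') ->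
        C (string i j') /\ C (string j i'),
      C (string i i') -> C (string i j') -> C (string j i') -> C (string j j') &
      C (string j j') -> C (string i j') -> C (string j i') -> C (string i i')].
Proof.
move=> iji' i'j'; have AS := ambient_string.
have [h1 h2 h3] := thick_2of3 thC (AS i i') (ambient_sum A_nilpotent (AS i j') (AS j i'))
  (AS j j') (crossing_exact k cov iji' i'j').
split=> [C1 C2|C1 C2 C3|C1 C2 C3].
- by split; [apply: (thick_suml thC _ _ (h2 C1 C2))
            | apply: (thick_sumr A_nilpotent thC _ _ (h2 C1 C2))].
- by apply: h1 => //; apply: thick_sum.
- by apply: h3 => //; apply: thick_sum.
Qed.

Definition linked x y := C (string (minn x y) (maxn x y)).

Lemma linkedE x y : (x <= y)%N -> linked x y = C (string x y).
Proof. by move=> xy; rewrite /linked (minn_idPl xy) (maxn_idPr xy). Qed.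

Lemma linked_refl x : linked x x.
Proof. by rewrite linkedE //; apply: thick_string_nil. Qed.

Lemma linked_sym x y : linked x y -> linked y x.
Proof. by rewrite /linked minnC maxnC. Qed.

(** The case [j = i'] of [thick_crossing], where the summand [j, j) is zero, is two-of-three for [i,
    j), [i, l), [j, l). Its three directions cover all relative orders of [x], [y], [z]. *)
Lemma linked_trans y x z : linked x y -> linked y z -> linked x z.
Proof.
have th i j l : (i <= j)%N -> (j <= l)%N ->
    [/\ linked i j -> linked j l -> linked i l,
        linked i j -> linked i l -> linked j l &
        linked j l -> linked i l -> linked i j].
  move=> ij jl; rewrite !linkedE ?(leq_trans ij) //.
  have iji : (i <= j <= j)%N by rewrite ij leqnn.
  have [h1 h2 h3] := thick_crossing iji jl; have nil := thick_string_nil (leqnn j).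
  by split=> C1 C2; [case: (h1 C1 C2) | apply: h2 | apply: h3].
have [xy|/ltnW yx] := leqP x y; have [yz|/ltnW zy] := leqP y z.
- by case: (th x y z).
- have [xz|/ltnW zx] := leqP x z; move=> lxy /linked_sym lzy.
    by case: (th x z y xz zy) => _ _; apply.
  by apply: linked_sym; case: (th z x y zx xy) => _ _; apply.
- have [xz|/ltnW zx] := leqP x z; move=> /linked_sym lyx lyz.
    by case: (th y x z yx xz) => _ h _; apply: h.
  by apply: linked_sym; case: (th y z x yz zx) => _ h _; apply: h.
- move=> /linked_sym lyx /linked_sym lzy; apply: linked_sym.
  by case: (th z y x) => // h _ _; apply: h.
Qed.

(** The string [j, i') is a summand of the middle term of [crossing_exact], so [j] is linked to
    [i'], hence to [i]. *)
Lemma linked_crossing i j i' j' : (i <= j <= i')%N -> (i' <= j')%N ->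
  linked i i' -> linked j j' -> linked i j.
Proof.
move=> iji' i'j'; have /andP[ij ji'] := iji'.
rewrite (linkedE (leq_trans ij ji')) (linkedE (leq_trans ji' i'j')) => C1 C2.
have [h _ _] := thick_crossing iji' i'j'; have [_ C3] := h C1 C2.
apply: (@linked_trans i'); first by rewrite linkedE ?(leq_trans ij ji').
by apply: linked_sym; rewrite linkedE.
Qed.

Lemma linked_shift n x y : (forall t v, pos (t + n) v = pos t v) ->
  linked (x + n) (y + n) <-> linked x y.
Proof.
move=> pern; rewrite /linked -addn_minl -addn_maxl.
have iso := string_shift k (minn x y) (maxn x y) pern.
split; apply: (thick_iso A_nilpotent thC) => //; try exact: ambient_string.
exact: rep_iso_sym.
Qed.

End OneThickStrings.
End ThickStrings.

Lemma inj_surj_bij (T S : Type) (f : T -> S) :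
  injective f -> (forall y, exists x, f x = y) -> bijective f.
Proof.
move=> inj_f sur; pose g y := projT1 (cid (sur y)).
have gK y : f (g y) = y by rewrite /g; case: cid.
by exists g => // x; apply: inj_f.
Qed.

(** * Noncrossing partitions, gaps and equivalence relations *)

Section Partitions.
Variables (m : nat).
Implicit Types (P : {set {set 'I_m}}) (i j a b : 'I_m).

Section OnePartition.
Variable P : {set {set 'I_m}}.
Hypothesis partP : partition P [set: 'I_m].

Let coverP x : x \in cover P. Proof. by rewrite (cover_partition partP) inE. Qed.

Lemma in_pblockE x y : (y \in pblock P x) = (pblock P x == pblock P y).
Proof. by rewrite eq_pblock // (partition_trivIset partP). Qed.

Lemma in_pblock_refl x : x \in pblock P x.
Proof. by rewrite mem_pblock. Qed.

Lemma in_pblock_sym x y : (y \in pblock P x) = (x \in pblock P y).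
Proof. by rewrite !in_pblockE eq_sym. Qed.

Lemma in_pblock_trans y x z : y \in pblock P x -> z \in pblock P y -> z \in pblock P x.
Proof. by rewrite !in_pblockE => /eqP->. Qed.

Lemma noncrossingP :
  reflect (forall i j i' j', (i < j < i')%N -> (i' < j')%N ->
             i' \in pblock P i -> j' \in pblock P j -> j \in pblock P i)
          (noncrossing P).
Proof.
apply: (iffP idP) => [ncP i j i' j' /andP[ij ji'] i'j' bi bj|ncP].
  have h x : pblock P x \in P by apply: pblock_mem.
  move/forall_inP/(_ _ (h i))/forall_inP/(_ _ (h j)): ncP.
  move/forall_inP/(_ _ (in_pblock_refl i))/forall_inP/(_ _ bi).
  move/forall_inP/(_ _ (in_pblock_refl j))/forall_inP/(_ _ bj).
  by rewrite ij ji' i'j' /= in_pblockE.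
have tr := partition_trivIset partP.
apply/forall_inP=> A PA; apply/forall_inP=> B PB.
apply/forall_inP=> i iA; apply/forall_inP=> i' i'A.
apply/forall_inP=> j jB; apply/forall_inP=> j' j'B.
apply/implyP=> /and3P[ij ji' i'j']; have eA := def_pblock tr PA iA.
have eB := def_pblock tr PB jB; rewrite -eA -eB -in_pblockE.
by apply: (ncP i j i' j'); rewrite ?ij ?eA ?eB.
Qed.

(* Gap [a] lies between the points [a] and [a + 1] on the circle; two gaps are  *)
(* in the same block of the Kreweras complement when no chord of a block of [P] *)
(* separates them.                                                              *)
Definition same_gap (a b : nat) : Prop :=
  forall i j, (i < j)%N -> j \in pblock P i -> (i <= a < j)%N = (i <= b < j)%N.

Hypothesis ncP : noncrossing P.

(* If [j] is not in the block of [i], the two gaps next to [s] and [t] are      *)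
(* separated by the chord from [i] to [j], where [s] and [t] are the cyclically *)
(* consecutive elements of the block of [i] around [j].                         *)
Lemma same_gap_closed i j : (i < j)%N ->
  (forall a b, (a < b)%N -> same_gap a b -> (i <= a < j)%N = (i <= b < j)%N) ->
  j \in pblock P i.
Proof.
move=> ij sep; apply: contraT => jNi.
have cross := noncrossingP ncP.
have [s /andP[si sj] maxs] : exists2 s, (s \in pblock P i) && (s < j)%N &
    forall r, r \in pblock P i -> (r < j)%N -> (r <= s)%N.
  have h : (i \in pblock P i) && (i < j)%N by rewrite in_pblock_refl.
  case: (@arg_maxnP _ i (fun s => (s \in pblock P i) && (s < j)%N) val h) => s hs maxs.
  by exists s => // r ri rj; apply: maxs; rewrite ri.
have is_ : (i <= s)%N by apply: maxs => //; apply: in_pblock_refl.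
have blk x y : x \in pblock P i -> y \in pblock P i -> y \in pblock P x.
  by rewrite (in_pblock_sym i) => /in_pblock_trans; apply.
have blkI x y : x \in pblock P i -> y \in pblock P x -> y \in pblock P i.
  exact: in_pblock_trans.
have blkJ x y : x \in pblock P i -> x \in pblock P y -> y \in pblock P i.
  by rewrite (in_pblock_sym y); apply: blkI.
have neq x y : x \in pblock P i -> y \notin pblock P i -> (x != y :> nat).
  by move=> xi; apply: contraNneq => /val_inj <-.
have nbetween (x : 'I_m) : (s < x)%N -> (x <= j)%N -> x \notin pblock P i.
  move=> sx xj; apply: contraTN sx => xi; rewrite -leqNgt; apply: maxs => //.
  by rewrite ltn_neqAle xj andbT neq.
(* If the block continues beyond [j], let [t] be its next element. A chord separating the gaps [s]
   and [t.-1] would cross the chord from [s] to [t], so these are the gaps to feed to [sep]: [s]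
   lies under the chord from [i] to [j], while [t.-1] does not. *)
have [/existsP[t0 ht0]|/existsPn nt] :=
    boolP [exists t : 'I_m, (t \in pblock P i) && (j < t)%N].
  case: (@arg_minnP _ t0 (fun t => (t \in pblock P i) && (j < t)%N) val ht0).
  move=> t /andP[ti jt] mint.
  have nin (x : 'I_m) : (s < x)%N -> (x < t)%N -> x \notin pblock P i.
    move=> sx xt; have [xj|jx] := leqP x j; first exact: nbetween.
    by apply: contraTN xt => xi; rewrite -leqNgt; apply: mint; rewrite xi.
  have tm : (t.-1 < m)%N by apply: leq_ltn_trans (ltn_ord t); apply: leq_pred.
  suff /(sep s (Ordinal tm)) : same_gap s t.-1.
    by move=> /= e; move: (e ltac:(lia)); lia.
  move=> x y xy yx; apply/idP/idP => /andP[xs sy].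
    have [ty|yt] := leqP t y; first by lia.
    have yN : y \notin pblock P i by apply: nin.
    have xN : x \notin pblock P i by apply: contra yN => xi; apply: blkI yx.
    have sNx := neq _ _ si xN.
    by case/negP: xN; apply: (blkJ s) => //; apply: (cross x s y t) => //; try exact: blk; lia.
  have [xs'|sx] := leqP x s; first by lia.
  have xN : x \notin pblock P i by apply: nin => //; lia.
  have yN : y \notin pblock P i by apply: contra xN => yi; apply: blkJ yx.
  have tNy := neq _ _ ti yN.
  case/negP: xN; apply: (blkI s) => //; apply: (cross s x t y) => //; try exact: blk; lia.
have sN (x : 'I_m) : (s < x)%N -> x \notin pblock P i.
  move=> sx; have [xj|jx] := leqP x j; first exact: nbetween.
  by apply: contraT => /negPn xi; have := nt x; rewrite xi jx.
(* No element of the block follows [j], so the cyclic successor of [s] is the least element [r]. The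
   gap before it is [r.-1], or for [r = 0] the last gap [m.-1], which lies under no chord. *)
case: (@arg_minnP _ i (fun r => r \in pblock P i) val (in_pblock_refl i)) => r ri minr.
have rs : (r <= s)%N by apply: leq_trans is_; apply: minr; apply: in_pblock_refl.
have jm := ltn_ord j; have sm := ltn_ord s.
have [r0|r_gt0] := posnP r.
  have mm : (m.-1 < m)%N by lia.
  suff /(sep s (Ordinal mm)) : same_gap s m.-1.
    by move=> /= e; move: (e ltac:(lia)); lia.
  move=> x y xy yx; have ym := ltn_ord y.
  rewrite [RHS](_ : _ = false); last by lia.
  apply/negP => /andP[xs sy]; have yN := sN y sy.
  have xN : x \notin pblock P i by apply: contra yN => xi; apply: blkI yx.
  have sNx := neq _ _ si xN; have rNx := neq _ _ ri xN.
  by case/negP: xN; apply: (blkI r) => //; apply: (cross r x s y) => //; try exact: blk; lia.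
have rm : (r.-1 < m)%N by lia.
suff /(sep (Ordinal rm) s) : same_gap r.-1 s.
  have ir := minr _ (in_pblock_refl i).
  by move=> /= e; move: (e ltac:(lia)) ir => /=; lia.
move=> x y xy yx; apply/idP/idP => /andP[xr ry].
  have [ys|sy] := leqP y s; last by lia.
  have xN : x \notin pblock P i.
    by apply: contraTN xr => /minr /=; lia.
  have yN : y \notin pblock P i by apply: contra xN => yi; apply: blkJ yx.
  have sNy := neq _ _ si yN; have rNy := neq _ _ ri yN.
  by case/negP: xN; apply: (blkJ r) => //; apply: (cross x r y s) => //; try exact: blk; lia.
have [xr'|rx] := ltnP x r; first by lia.
have yN := sN y ry.
have xN : x \notin pblock P i by apply: contra yN => xi; apply: blkI yx.
have sNx := neq _ _ si xN; have rNx := neq _ _ ri xN.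
by case/negP: xN; apply: (blkI r) => //; apply: (cross r x s y) => //; try exact: blk; lia.
Qed.

End OnePartition.

Section TwoPartitions.
Variables (P P' : {set {set 'I_m}}).
Hypotheses (partP : partition P [set: 'I_m]) (partP' : partition P' [set: 'I_m]).

Lemma refinesP :
  reflect (forall x y, y \in pblock P x -> y \in pblock P' x) (refines P P').
Proof.
have tr := partition_trivIset partP; have tr' := partition_trivIset partP'.
apply: (iffP forall_inP) => [ref x y yx|ref A PA].
  have PPx : pblock P x \in P by apply: pblock_mem; rewrite (cover_partition partP) inE.
  have /exists_inP[B PB /subsetP sB] := ref _ PPx.
  by rewrite (def_pblock tr' PB (sB _ (in_pblock_refl partP x))) sB.
have /set0Pn[x xA] := partition_neq0 partP PA.
apply/exists_inP; exists (pblock P' x).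
  by apply: pblock_mem; rewrite (cover_partition partP') inE.
by apply/subsetP=> y yA; apply: ref; rewrite (def_pblock tr PA xA).
Qed.

Lemma partition_eq : (forall x y, (y \in pblock P x) = (y \in pblock P' x)) -> P = P'.
Proof.
move=> PP'; rewrite -(equivalence_partition_pblock partP).
rewrite -[RHS](equivalence_partition_pblock partP'); congr equivalence_partition.
by apply/funext=> x; apply/funext=> y.
Qed.

End TwoPartitions.

Section FromRelation.
Variable E : nat -> nat -> Prop.
Hypotheses (E_refl : forall x, E x x) (E_sym : forall x y, E x y -> E y x)
  (E_trans : forall x y z, E x y -> E y z -> E x z).

Definition classes_of : {set {set 'I_m}} :=
  equivalence_partition (fun i j : 'I_m => `[< E i j >]) [set: 'I_m].

Let E_equiv : {in [set: 'I_m] & &, equivalence_rel (fun i j : 'I_m => `[< E i j >])}.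
Proof.
move=> x y z _ _ _; split; first exact/asboolP/E_refl.
move=> /asboolP xy; apply/asboolP/asboolP; apply: E_trans => //; exact: E_sym.
Qed.

Lemma classes_of_partition : partition classes_of [set: 'I_m].
Proof. exact: equivalence_partitionP. Qed.

Lemma in_classes_of i j : j \in pblock classes_of i <-> E i j.
Proof.
by rewrite pblock_equivalence_partition ?inE //; split=> /asboolP.
Qed.

Lemma classes_of_noncrossing :
  (forall i j i' j', (i < j < i')%N -> (i' < j' < m)%N ->
     E i i' -> E j j' -> E i j) -> noncrossing classes_of.
Proof.
move=> nc; apply/(noncrossingP classes_of_partition) => i j i' j' iji' i'j'.
move=> /in_classes_of Ei /in_classes_of Ej; apply/in_classes_of.
by apply: (nc i j i' j'); rewrite // i'j' ltn_ord.
Qed.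

End FromRelation.
End Partitions.

(** * The half turn, and folding periodic relations modulo 2n *)

Lemma barE n (x : 'I_(n + n)) : bar x = (if x < n then x + n else x - n)%N :> nat.
Proof.
rewrite /bar; case: (splitP x) => y e; rewrite e /=.
  by rewrite addnC.
by rewrite addKn.
Qed.

Lemma barK n : involutive (@bar n).
Proof.
move=> x; apply/val_inj; have := ltn_ord x; rewrite /= barE; have := barE x.
by case: (ltnP x n) => ?; case: (ltnP (bar x) n) => ?; lia.
Qed.

Lemma bar_closedP n (P : {set {set 'I_(n + n)}}) : partition P [set: 'I_(n + n)] ->
  reflect (forall x y, y \in pblock P x -> bar y \in pblock P (bar x))
          [forall A in P, [set bar x | x in A] \in P].
Proof.
move=> partP; have tr := partition_trivIset partP.
have PPx x : pblock P x \in P by apply: pblock_mem; rewrite (cover_partition partP) inE.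
apply: (iffP forall_inP) => [clP x y yx|clP A PA].
  by rewrite (def_pblock tr (clP _ (PPx x))) imset_f // in_pblock_refl.
have /set0Pn[x xA] := partition_neq0 partP PA.
suff -> : [set bar x | x in A] = pblock P (bar x) by [].
apply/setP=> y; rewrite -(def_pblock tr PA xA).
apply/imsetP/idP => [[z zx ->]|yx]; first exact: clP.
by exists (bar y); [have := clP _ _ yx; rewrite barK | rewrite barK].
Qed.

Record periodic_noncrossing (n : nat) (R : nat -> nat -> Prop) : Prop := PeriodicNoncrossing {
  pnc_refl : forall x, R x x;
  pnc_sym : forall x y, R x y -> R y x;
  pnc_trans : forall y x z, R x y -> R y z -> R x z;
  pnc_shift : forall x y, R (x + n)%N (y + n)%N <-> R x y;
  pnc_cross : forall i j i' j', (i <= j <= i')%N -> (i' <= j')%N ->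
    R i i' -> R j j' -> R i j
}.

Section PeriodicRelation.
Variables (n : nat) (R : nat -> nat -> Prop).
Hypothesis ncR : periodic_noncrossing n R.

Let R_refl := pnc_refl ncR.
Let R_sym := pnc_sym ncR.
Let R_trans := pnc_trans ncR.
Let R_shift := pnc_shift ncR.
Let R_cross := pnc_cross ncR.

(** Positions are naturals, so both end points are translated upwards. *)
Definition modulo_2n x y := exists p q, R (x + (n + n) * p)%N (y + (n + n) * q)%N.

Lemma R_shift_mul p x y : R (x + n * p) (y + n * p) <-> R x y.
Proof.
by elim: p => [|p IHp]; rewrite ?muln0 ?addn0 // mulnS (addnC n) !addnA R_shift.
Qed.

Lemma R_shift2_mul p x y : R (x + (n + n) * p) (y + (n + n) * p) <-> R x y.
Proof.
have -> : ((n + n) * p = n * (p + p))%N by rewrite mulnDl mulnDr.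
exact: R_shift_mul.
Qed.

(** The chord from [x] to [y] crosses its own translate by [n], whose left end is [x + n]. *)
Lemma R_long x y : (x + n <= y)%N -> R x y -> R x (x + n).
Proof.
by move=> xy Rxy; apply: (R_cross (i' := y) (j' := (y + n)%N)); rewrite ?R_shift //; lia.
Qed.

Lemma R_full p x : R x (x + n) -> R x (x + (n + n) * p)%N.
Proof.
move=> Rx; have -> : ((n + n) * p = n * (p + p))%N by rewrite mulnDl mulnDr.
elim: (p + p)%N => [|q IHq]; first by rewrite muln0 addn0.
by apply: (R_trans IHq); rewrite mulnS addnA R_shift_mul.
Qed.

Lemma modulo_2n_R x y : R x y -> modulo_2n x y.
Proof. by exists 0%N, 0%N; rewrite muln0 !addn0. Qed.

Lemma modulo_2n_refl x : modulo_2n x x. Proof. exact: modulo_2n_R. Qed.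

Lemma modulo_2n_sym x y : modulo_2n x y -> modulo_2n y x.
Proof. by move=> [p] [q] /R_sym; exists q, p. Qed.

Lemma modulo_2n_trans y x z : modulo_2n x y -> modulo_2n y z -> modulo_2n x z.
Proof.
move=> [p] [q] xy [r] [s] yz; exists (p + r)%N, (s + q)%N.
move/(R_shift2_mul r): xy; move/(R_shift2_mul q): yz.
rewrite -!addnA -!mulnDr (addnC q) => yz xy.
exact: R_trans xy yz.
Qed.

Lemma modulo_2n_wrap x : modulo_2n x (x + (n + n)).
Proof. by exists 1%N, 0%N; rewrite muln1 muln0 addn0. Qed.

Lemma modulo_2n_shift x y : modulo_2n x y -> modulo_2n (x + n) (y + n).
Proof.
by move=> [p] [q] xy; exists p, q; rewrite !(addnAC _ n) R_shift.
Qed.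

(** If the two translations differ, the resulting chord has length at least [n] (when [p > q] this
    uses [y <= x + n]); then [R_long] and [R_full] relate its left end to its translates, and the
    surplus multiple of 2n cancels. *)
Lemma modulo_2nE x y : (x <= y <= x + n)%N -> modulo_2n x y <-> R x y.
Proof.
move=> /andP[xy yx]; split; last exact: modulo_2n_R.
move=> [p] [q]; have [pq|qp] := leqP p q.
  rewrite -(subnK pq) mulnDr addnA R_shift2_mul => Rxy.
  case: (posnP (q - p)) Rxy => [->|qp]; first by rewrite muln0 addn0.
  move=> Rxy; have /R_full-/(_ (q - p)%N) Rx : R x (x + n).
    by apply: R_long Rxy; have := leq_pmulr (n + n) qp; lia.
  apply/(R_shift2_mul (q - p)); exact: R_trans (R_sym Rx) Rxy.
rewrite -(subnK (ltnW qp)) mulnDr addnA R_shift2_mul => /R_sym Ryx.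
have /R_full-/(_ (p - q)%N) Ry : R y (y + n).
  apply: R_long Ryx; have : (0 < p - q)%N by rewrite subn_gt0.
  by move/(leq_pmulr (n + n)); lia.
by apply/(R_shift2_mul (p - q)); apply: R_trans (R_sym Ryx) Ry.
Qed.

(** On a circle of 2n points one of the two arcs of a chord has length at most [n], so each chord
    lifts to an [R]-chord by [modulo_2nE]. Each of the four combinations is an instance of [R_cross]
    on the cover. *)
Lemma modulo_2n_crossing i j i' j' : (i < j < i')%N -> (i' < j')%N -> (j' < i + (n + n))%N ->
  modulo_2n i i' -> modulo_2n j j' -> modulo_2n i j.
Proof.
move=> /andP[ij ji'] i'j' j'i.
have short x x' : (x < x')%N -> (x' < x + (n + n))%N -> modulo_2n x x' ->
    R x x' \/ R x' (x + (n + n)).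
  move=> xx' x'x xEx'; have [le|gt] := leqP x' (x + n).
    by left; apply/modulo_2nE => //; lia.
  right; apply/modulo_2nE; first by lia.
  exact: modulo_2n_trans (modulo_2n_sym xEx') (modulo_2n_wrap x).
have R2 x y : R x y -> R (x + (n + n)) (y + (n + n)) by rewrite !addnA !R_shift.
have wrap := modulo_2n_wrap; have E := modulo_2n_R; have tr := modulo_2n_trans.
have sy := modulo_2n_sym.
move=> Ei Ej.
have ii' : (i < i')%N by lia.
have i'i : (i' < i + (n + n))%N by lia.
have jj' : (j < j')%N by lia.
have j'j : (j' < j + (n + n))%N by lia.
have [Ri|Ri] := short _ _ ii' i'i Ei; have [Rj|Rj] := short _ _ jj' j'j Ej.
- by apply: E; apply: (R_cross _ _ Ri Rj); lia.
- have /E e : R j' (i + (n + n)).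
    by apply: (R_cross _ _ Rj (R2 _ _ Ri)); lia.
  exact: tr (wrap i) (tr _ _ _ (sy _ _ e) (sy _ _ Ej)).
- have /E e : R j i' by apply: (R_cross _ _ Rj Ri); lia.
  exact: tr Ei (sy _ _ e).
- have /E e : R i' j' by apply: (R_cross _ _ Ri Rj); lia.
  exact: tr Ei (tr _ _ _ e (sy _ _ Ej)).
Qed.

End PeriodicRelation.

(** Chords of length at most [n] survive folding by [modulo_2nE]; by [R_long] a longer one is a
    chain of steps of length [n] and a short remainder. *)
Lemma modulo_2n_sub n (R R' : nat -> nat -> Prop) : (0 < n)%N ->
  periodic_noncrossing n R -> periodic_noncrossing n R' ->
  (forall i j : 'I_(n + n), modulo_2n n R i j -> modulo_2n n R' i j) ->
  forall x y, R x y -> R' x y.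
Proof.
move=> n_gt0 ncR ncR' sub; have nn0 : (0 < n + n)%N by lia.
have reduce S x : periodic_noncrossing n S -> modulo_2n n S x (x %% (n + n)).
  move=> ncS; exists 0%N, (x %/ (n + n))%N.
  rewrite muln0 addn0 {1}(divn_eq x (n + n)) addnC mulnC.
  exact: pnc_refl ncS _.
have short x y : (x <= y <= x + n)%N -> R x y -> R' x y.
  move=> xyn Rxy; apply/(modulo_2nE ncR' xyn).
  pose u z : 'I_(n + n) := Ordinal (ltn_pmod z nn0).
  have Ru : modulo_2n n R (u x) (u y).
    apply: (modulo_2n_trans ncR (y := x)).
      by apply: (modulo_2n_sym ncR); apply: reduce.
    by apply: (modulo_2n_trans ncR (y := y)); [apply: modulo_2n_R | apply: reduce].
  apply: (modulo_2n_trans ncR' (y := u x)); first exact: reduce.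
  apply: (modulo_2n_trans ncR' (y := u y)); first exact: sub.
  by apply: (modulo_2n_sym ncR'); apply: reduce.
move=> x y; wlog xy : x y / (x <= y)%N => [h|].
  have [|/ltnW yx] := leqP x y; first exact: h.
  by move=> /(pnc_sym ncR)/(h _ _ yx)/(pnc_sym ncR').
have [m] := ubnP (y - x); elim: m x xy => // m IHm x xy ym Rxy.
have [yx|xy'] := leqP y (x + n); first by apply: short; rewrite ?xy.
have Rx := R_long ncR (ltnW xy') Rxy.
apply: (pnc_trans ncR' (y := (x + n)%N)); first by apply: short => //; rewrite leqnn leq_addr.
have Rxny : R (x + n)%N y by apply: (pnc_trans ncR (pnc_sym ncR Rx)).
by apply: IHm Rxny; lia.
Qed.

(** * From end point relations to an order isomorphism *)

Lemma thick_le_antisym (k : fieldType) (Q : quiver) (A : rep k Q -> Prop)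
    (C D : thick_subcategory A) : thick_le C D -> thick_le D C -> C = D.
Proof.
case: C D => [C thC] [D thD] CD DC; apply: eq_exist; apply/funext=> M; apply: propext.
by split; [apply: CD | apply: DC].
Qed.

(** Injectivity follows from comparing inclusions in both directions, surjectivity from the last
    hypothesis, since a partition is determined by its block relation. *)
Lemma thick_classification (k : fieldType) (Q : quiver) (A : rep k Q -> Prop)
    (m : nat) (good : pred {set {set 'I_m}})
    (E : thick_subcategory A -> nat -> nat -> Prop) :
  (forall P, good P -> partition P [set: 'I_m]) ->
  (forall C x, E C x x) -> (forall C x y, E C x y -> E C y x) ->
  (forall C x y z, E C x y -> E C y z -> E C x z) ->
  (forall C, good (classes_of m (E C))) ->
  (forall C D, thick_le C D <-> forall i j : 'I_m, E C i j -> E D i j) ->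
  (forall P, good P -> exists C, forall i j : 'I_m, E C i j <-> j \in pblock P i) ->
  exists phi : thick_subcategory A -> {P | good P},
    [/\ bijective phi,
        forall C D, thick_le C D <-> refines (val (phi C)) (val (phi D)) &
        forall C (i j : 'I_m), j \in pblock (val (phi C)) i <-> E C i j].
Proof.
move=> good_part E_refl E_sym E_trans E_good E_le E_sur.
pose phi C : {P | good P} := exist _ (classes_of m (E C)) (E_good C).
have partP C := good_part _ (E_good C).
have phiE C i j : j \in pblock (val (phi C)) i <-> E C i j.
  by apply: in_classes_of; [apply: E_refl | apply: E_sym | apply: E_trans].
have le_phi C D : thick_le C D <-> refines (val (phi C)) (val (phi D)).
  rewrite E_le; split=> [CD|/(refinesP (partP C) (partP D)) CD i j /phiE/CD/phiE//].
  by apply/(refinesP (partP C) (partP D)) => i j /phiE/CD/phiE.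
exists phi; split=> //; apply: inj_surj_bij => [C D CD|P].
  by apply: thick_le_antisym; apply/le_phi; rewrite CD;
    apply/(refinesP (partP D) (partP D)).
have [C CP] := E_sur _ (valP P); exists C; apply: val_inj.
apply: (partition_eq (partP C) (good_part _ (valP P))) => i j.
by apply/idP/idP => [/phiE/CP|/CP/phiE].
Qed.

(** * The linear quiver *)

Section Linear.
Variables (k : fieldType) (n : nat).
Notation Q := (linear_quiver n).

Definition linear_pos (t : nat) (v : vertex Q) : bool := t == v :> nat.

Lemma linear_covering : covering linear_pos.
Proof.
split=> [t u v /eqP tu /eqP tv|t a|t v /eqP tv|v|a b].
- by apply: val_inj; rewrite /= -tu -tv.
- by case: a => -[x y] /= /eqP xy; rewrite /linear_pos /= xy eqSS.
- have tn : (t < n)%N by have := ltn_ord v; lia.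
  have pr : (v, Ordinal tn).1 == (v, Ordinal tn).2.+1 :> nat by rewrite /= -tv.
  by exists (exist _ (v, Ordinal tn) pr).
- by exists v; apply: eqxx.
- case: a b => -[x y] /= xy [[x' y'] /= xy'] e; subst x'; apply: val_inj => /=.
  congr pair; apply: val_inj => /=.
  by apply/eqP; rewrite -eqSS -(eqP xy) -(eqP xy').
Qed.

(** A nonzero walk of length [n] would start at a position that is at least [n], over which there is
    no vertex. *)
Lemma linear_nilpotent (M : rep k Q) : cat_A M <-> nilpotent M.
Proof.
split=> // _; exists n => v u; apply/lfunP=> x; rewrite zero_lfunE.
apply/eqP; apply: contraT => /(walk_pos_source linear_covering)/(_ (eqxx (u : nat))).
by move=> /eqP e; have := ltn_ord v; lia.
Qed.

Lemma interval_rep_iso i j : (j <= n)%N ->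
  rep_iso (string_rep k linear_pos i j) (interval_rep k n i j).
Proof.
move=> jn; apply: (@thin_rep_iso k Q linear_pos i j
  (fun v : 'I_n => i <= v < j)%N (fun=> 1)).
- move=> v; split=> [/andP[iv vj]|[t /and3P[it tj /eqP<-]]]; last by rewrite it.
  by exists v; rewrite /on_string iv vj; apply: eqxx.
- by move=> t s v /and3P[_ _ /eqP->] /and3P[_ _ /eqP->].
- move=> [[x y] /= /eqP xy] t s /and3P[_ _ /eqP->] /and3P[_ _ /eqP->].
  by rewrite /= xy eqxx.
Qed.

Section FromPartition.
Variable P : {set {set 'I_n.+1}}.

(* The gap [n] carries no vertex; pairing it with [a] asks [M] to vanish at [a], *)
(* which is expressed by making the (zero) action of a closed walk at [a]        *)
(* bijective.                                                                    *)
Definition linear_walks d (v u : vertex Q) : Prop :=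
  exists a b, [/\ (a < b <= n)%N, same_gap P a b, d = (b - a)%N, u = a :> nat &
    if (b < n)%N then v = b :> nat else v = u].

(** For gaps [a] and [b] below [n], bijectivity of the walk says that the string contains both
    positions or neither, that is, the chord from [i] to [j] does not separate these gaps;
    [same_gap_closed] concludes. *)
Lemma linear_perp_string (i j : 'I_n.+1) : partition P [set: 'I_n.+1] -> noncrossing P ->
  (i < j)%N ->
  perp (@cat_A k n) linear_walks (string_rep k linear_pos i j) <-> j \in pblock P i.
Proof.
move=> partP ncP ij; have jn := ltn_ord j; rewrite ltnS in jn.
have bijP d v u := string_walk_bij k linear_covering i j d v u.
split=> [[_ H]|ji].
  apply: same_gap_closed => // a b ab gap.
  have an : (a < n)%N by have := ltn_ord b; lia.
  have bn : (b <= n)%N by have := ltn_ord b; lia.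
  have [bn'|nb] := ltnP b n.
    have /H/bijP[H1 H2] : linear_walks (b - a) (Ordinal bn') (Ordinal an).
      by exists a, b; rewrite ab bn bn'.
    apply/idP/idP => /andP[ix xj].
      have /H1 : on_string linear_pos i j a (Ordinal an).
        by rewrite /on_string ix xj /linear_pos /=.
      by rewrite /on_string /linear_pos /=; lia.
    have /H2 : on_string linear_pos i j b (Ordinal bn').
      by rewrite /on_string ix xj /linear_pos /=.
    by rewrite /on_string /linear_pos /=; lia.
  (* Now [b = n]: a closed walk of positive length acts as zero, so its bijectivity keeps [a] out of
     the string. The gap [n] is never under the chord, as [j <= n]. *)
  have /H/bijP[H1 H2] : linear_walks (b - a) (Ordinal an) (Ordinal an).
    by exists a, b; rewrite ab bn ifF //; lia.
  rewrite [RHS](_ : _ = false); last by lia.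
  apply/negP => /andP[ix xj].
  have /H1 : on_string linear_pos i j a (Ordinal an).
    by rewrite /on_string ix xj /linear_pos /=.
  by rewrite /on_string /linear_pos /=; lia.
split=> // d v u [a] [b] [/andP[ab bn] gap -> ua vb]; apply/bijP.
have gij := gap _ _ ij ji.
split=> t /and3P[it tj /eqP tv]; rewrite /on_string /linear_pos.
  by case: ltnP vb => [bn' vb|nb _]; lia.
by case: ltnP vb => [bn' vb|nb vb]; [lia | move: (congr1 val vb) => /=; lia].
Qed.

End FromPartition.

Lemma linear_string_trunc i j : (n <= j)%N ->
  rep_iso (string_rep k linear_pos i n) (string_rep k linear_pos i j).
Proof.
move=> nj; apply: (string_map_iso _ linear_covering) => // t v.
apply/and3P/and3P => -[it tj /eqP tv]; split=> //; try exact/eqP; last by rewrite tv.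
exact: leq_trans nj.
Qed.

Lemma thick_linear :
  exists phi : thick_subcategory (@cat_A k n) -> NC n.+1,
     [/\ bijective phi,
         (forall C D : thick_subcategory (@cat_A k n),
            thick_le C D <-> refines (val (phi C)) (val (phi D))) &
         (forall (C : thick_subcategory (@cat_A k n)) (i j : 'I_n.+1),
            (i < j)%N ->
            j \in pblock (val (phi C)) i <-> sval C (interval_rep k n i j))].
Proof.
pose Nil := linear_nilpotent; pose cov := linear_covering.
pose E (C : thick_subcategory (@cat_A k n)) := linked linear_pos (sval C).
have E_refl C x : E C x x by apply: (linked_refl cov Nil (svalP C)).
have E_sym C x y : E C x y -> E C y x by apply: linked_sym.
have E_trans C x y z : E C x y -> E C y z -> E C x z.
  exact: (linked_trans cov Nil (svalP C)).
case: (@thick_classification k _ (@cat_A k n) n.+1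
         (fun P => partition P [set: 'I_n.+1] && noncrossing P) E) => //.
- by move=> P /andP[].
- move=> C; rewrite (classes_of_partition _ (E_refl C) (@E_sym C) (@E_trans C)) /=.
  apply: (classes_of_noncrossing (E_refl C) (@E_sym C) (@E_trans C)).
  move=> i j i' j' iji' /andP[i'j' _] Ei Ej.
  have i'j'_le := ltnW i'j'; have iji'_le : (i <= j <= i')%N by clear -iji'; lia.
  exact: (linked_crossing cov Nil (svalP C) iji'_le i'j'_le Ei Ej).
- move=> C D; split=> [CD i j|CD]; first exact: CD.
  apply: (thick_le_string cov Nil (svalP C) (svalP D)) => i j.
  wlog jn : j / (j <= n)%N => [h|].
    have [|nj] := leqP j n; first exact: h.
    have iso := linear_string_trunc i (ltnW nj); move/(thick_iso Nil (svalP C)) => Cij.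
    apply: (thick_iso Nil (svalP D) iso) => //; apply: h => //.
    by apply: Cij => //; apply: rep_iso_sym.
  have [ij|ji _] := leqP i j; last exact: (thick_string_nil cov Nil (svalP D) (ltnW ji)).
  have := CD (inord i) (inord j); rewrite /E !linkedE !inordK //; exact: leq_trans jn.
- move=> P /andP[partP ncP].
  have thP : thick (@cat_A k n) (perp (@cat_A k n) (linear_walks P)).
    apply: thick_perp; exists (string_rep k linear_pos 0 0); split=> // v z.
    exact: string_rep0.
  exists (exist _ _ thP) => i j; wlog ij : i j / (i <= j)%N => [h|].
    have [|/ltnW ji] := leqP i j; first exact: h.
    rewrite in_pblock_sym // -(h j i ji); split; exact: E_sym.
  have [/val_inj->|ij'] := eqVneq (i : nat) j.
    by rewrite in_pblock_refl //; split=> // _; apply: E_refl.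
  rewrite /E linkedE //; apply: linear_perp_string => //.
  by rewrite ltn_neqAle ij'.
- move=> phi [bij_phi le_phi phiE]; exists phi; split=> // C i j ij.
  rewrite phiE /E linkedE 1?ltnW //; have jn : (j <= n)%N by rewrite -ltnS.
  have iso := interval_rep_iso i jn.
  by split; apply: (thick_iso Nil (svalP C)) => //; apply: rep_iso_sym.
Qed.

End Linear.

Lemma modulo_2n_bar (n : nat) (R : nat -> nat -> Prop) (x y : 'I_(n + n)) :
  periodic_noncrossing n R -> modulo_2n n R x y -> modulo_2n n R (bar x) (bar y).
Proof.
move=> ncR; have toBar (z : 'I_(n + n)) : modulo_2n n R (z + n)%N (bar z).
  have := barE z; have zn := ltn_ord z; case: ltnP => [_ ->|nz bz].
    exact: modulo_2n_refl.
  have -> : (z + n = bar z + (n + n))%N by lia.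
  by apply: (modulo_2n_sym ncR); apply: modulo_2n_wrap.
move=> /(modulo_2n_shift ncR) xy.
exact: (modulo_2n_trans ncR (modulo_2n_sym ncR (toBar x)) (modulo_2n_trans ncR xy (toBar y))).
Qed.

(* A chord of the [2n]-gon, or the one obtained from it by [bar], spans at most *)
(* [n] positions.                                                               *)
Lemma bar_short_chords n (F G : 'I_(n + n) -> 'I_(n + n) -> Prop) :
  (forall x y, F x y -> F y x) -> (forall x y, G x y -> G y x) ->
  (forall x, G x x) ->
  (forall x y, F x y -> F (bar x) (bar y)) ->
  (forall x y, G x y -> G (bar x) (bar y)) ->
  (forall i j : 'I_(n + n), (i < j <= i + n)%N -> F i j -> G i j) ->
  forall i j, F i j -> G i j.
Proof.
move=> F_sym G_sym G_refl F_bar G_bar FG i j.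
wlog ij : i j / (i < j)%N => [h Fij|].
  have [lt|gt|/val_inj->//] := ltngtP i j; first exact: h.
  by apply/G_sym/h => //; apply: F_sym.
have [jin|inj] := leqP j (i + n) => Fij; first by apply: FG; rewrite ?ij.
rewrite -[i]barK -[j]barK; apply/G_bar/G_sym/FG; last exact/F_sym/F_bar.
have := barE i; have := barE j; have := ltn_ord j.
by case: (ltnP i n) => ?; case: (ltnP j n) => ?; lia.
Qed.

(** * The cyclic quiver *)

Section Cyclic.
Variables (k : fieldType) (n : nat).
Notation Q := (cyclic_quiver n).

Definition cyclic_pos (t : nat) (v : vertex Q) : bool := t == v %[mod n].

Lemma cyclic_posE t v : cyclic_pos t v = (t %% n == v)%N.
Proof. by rewrite /cyclic_pos (modn_small (ltn_ord v)). Qed.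

Lemma cyclic_covering : covering cyclic_pos.
Proof.
split=> [t u v|t a|t v _|v|a b //].
- by rewrite !cyclic_posE => /eqP tu /eqP tv; apply: val_inj; rewrite /= -tu -tv.
- have an := ltn_ord a; rewrite !/(cyclic_pos _ _) /= modn_mod.
  rewrite -(eqn_modDr n t.+1) -(eqn_modDr 1 t) !addn1 prednK ?ltn_addl //; last by lia.
  by rewrite eqn_modDr modnDr.
- by exists v.
- by exists v; apply: eqxx.
Qed.

Lemma cyclic_pos_shift t v : cyclic_pos (t + n) v = cyclic_pos t v.
Proof. by rewrite /cyclic_pos modnDr. Qed.

Lemma walk_path_act (M : rep k Q) l v :
  walk M l v (iter l (@ord_pred n) v) = path_act M l v.
Proof.
apply/lfunP=> x; elim: l => [|l IHl]; first by rewrite walk0 id_lfunE.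
by rewrite comp_lfunE -IHl (walk_act cyclic_covering).
Qed.

Lemma walk_path_end (M : rep k Q) l v u x :
  walk M l v u x != 0 -> u = iter l (@ord_pred n) v.
Proof.
move=> nz; have [t tu] := pos_ex cyclic_covering u.
have := walk_pos_source cyclic_covering nz tu => tv.
apply: (pos_uniq cyclic_covering tu).
elim: l v {nz x} tv => [|l IHl] v; first by rewrite addn0.
rewrite addnS => tv; rewrite iterSr; apply: IHl.
by rewrite -(pos_arrow cyclic_covering _ (v : arrow Q)).
Qed.

Lemma cyclic_nilpotent (M : rep k Q) : cat_At M <-> nilpotent M.
Proof.
split=> -[l Ml]; exists l; last by move=> v; rewrite -walk_path_act.
move=> v u; apply/lfunP=> x; rewrite zero_lfunE; apply/eqP/negPn/negP => nz.
have uE := walk_path_end nz; subst u.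
by move/eqP: nz; rewrite walk_path_act Ml zero_lfunE.
Qed.

(** Length at most [n] leaves at most one position of the string over each vertex, as [thin_rep_iso]
    requires. *)
Lemma uniserial_rep_iso i j : (j <= i + n)%N ->
  rep_iso (string_rep k cyclic_pos i j) (uniserial_rep k n i j).
Proof.
move=> jin.
have uniq_on t s v : on_string cyclic_pos i j t v -> on_string cyclic_pos i j s v -> t = s.
  rewrite /on_string !cyclic_posE => /and3P[it tj /eqP tv] /and3P[is_ sj /eqP sv].
  have: t == s %[mod n] by rewrite tv sv.
  wlog ts : t s it tj is_ sj {tv sv} / (t <= s)%N => [h|].
    have [ts|/ltnW st] := leqP t s; first exact: h.
    by rewrite eq_sym => e; apply/esym; apply: h.
  rewrite eq_sym eqn_mod_dvd // => /dvdnP[[|q]]; rewrite ?mulSn; lia.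
apply: (@thin_rep_iso k Q cyclic_pos i j
  (fun v : 'I_n => [exists t : 'I_j, (i <= t)%N && (t == v %[mod n])%N])
  (fun v : 'I_n => (v != i %[mod n])%N%:R)) => // [v|a t s].
  split=> [/existsP[t /andP[it tv]]|[t /and3P[it tj tv]]].
    by exists t; apply/and3P; split.
  by apply/existsP; exists (Ordinal tj); rewrite it.
move=> /and3P[it tj ta] /and3P[is_ sj sa]; congr (_%:R)%R; congr nat_of_bool.
have sa' : cyclic_pos s.+1 a by rewrite (pos_arrow cyclic_covering).
(* The scalar 0 matters when [j = i + n]: the arrow leaving the socle position [i] then ends at the
   vertex under the top position [j - 1]. *)
apply/idP/eqP => [ai|ts].
  have [s1|] := ltnP s.+1 j.
    by apply: (uniq_on _ _ a); rewrite /on_string ?it ?tj ?ta ?s1 ?sa' ?leqW.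
  move=> js; have sE : s.+1 = j by lia.
  have it' : (i < t)%N.
    by rewrite ltn_neqAle it andbT; apply: contraNneq ai => ->; rewrite eq_sym.
  have : on_string cyclic_pos i j t.-1 (target (a : arrow Q)).
    by rewrite /on_string -(pos_arrow cyclic_covering) prednK ?ta //; lia.
  have : on_string cyclic_pos i j s (target (a : arrow Q)) by rewrite /on_string is_ sj.
  by move=> /uniq_on h /h; lia.
apply/negP => /eqP ia; suff : t = i by lia.
by apply: (uniq_on _ _ a); rewrite /on_string ?it ?tj ?ta // /cyclic_pos ia eqxx; lia.
Qed.

Section FromPartition.
Variable P : {set {set 'I_(n + n)}}.
Hypotheses (partP : partition P [set: 'I_(n + n)]) (ncP : noncrossing P)
  (barP : forall x y, y \in pblock P x -> bar y \in pblock P (bar x)).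

Definition cyclic_walks d (v u : vertex Q) : Prop :=
  exists a b, [/\ (a < b <= a + n)%N && (b < n + n)%N, same_gap P a b, d = (b - a)%N,
    cyclic_pos a u & cyclic_pos b v].

Let nbar a := (if a < n then a + n else a - n)%N.

(** Rotating a chord by [n] may make it wrap around and exchange its two sides, but whether two gaps
    lie on the same side is unaffected. *)
Lemma same_gap_bar a b : (a < n + n)%N -> (b < n + n)%N ->
  same_gap P a b -> same_gap P (nbar a) (nbar b).
Proof.
move=> a2n b2n gap i j ij ji; have bji := barP ji.
have bij : bar i \in pblock P (bar j) by rewrite in_pblock_sym.
have i2n := ltn_ord i; have j2n := ltn_ord j.
have := barE i; have := barE j; rewrite /nbar.
have [lt|gt|e] := ltngtP (bar i) (bar j).
- have := gap _ _ lt bji; move: lt; move: (nat_of_ord (bar i)) (nat_of_ord (bar j)) => x y.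
  clear -ij a2n b2n i2n j2n.
  by case: (ltnP i n) => ?; case: (ltnP j n) => ?; case: (ltnP a n) => ?;
    case: (ltnP b n) => ?; lia.
- have := gap _ _ gt bij; move: gt; move: (nat_of_ord (bar i)) (nat_of_ord (bar j)) => x y.
  clear -ij a2n b2n i2n j2n.
  by case: (ltnP i n) => ?; case: (ltnP j n) => ?; case: (ltnP a n) => ?;
    case: (ltnP b n) => ?; lia.
- by move: e; case: (ltnP i n) => ?; case: (ltnP j n) => ?; lia.
Qed.

Lemma eq_mod_2n a t : (0 < n)%N -> (a < n + n)%N -> (t < n + n)%N -> a = t %[mod n] ->
  [\/ t = a, t = (a + n)%N | a = (t + n)%N].
Proof.
move=> n0 a2 t2 e; have ea := divn_eq a n; have et := divn_eq t n; rewrite e in ea.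
have ha : (a %/ n < 2)%N by rewrite ltn_divLR // mul2n -addnn.
have ht : (t %/ n < 2)%N by rewrite ltn_divLR // mul2n -addnn.
have [[p|p] [q|q]] : (a %/ n = 0 \/ a %/ n = 1)%N /\ (t %/ n = 0 \/ t %/ n = 1)%N.
  by move: (a %/ n)%N (t %/ n)%N ha ht => c d; lia.
all: move: ea et; rewrite p q; move: (t %% n)%N => r ea et.
- by constructor 1; lia.
- by constructor 2; lia.
- by constructor 3; lia.
- by constructor 1; lia.
Qed.

(** As in the linear case, a walk compares two gaps, but it only sees vertices modulo [n]. Gaps thus
    matter up to the half turn, and invariance of [P] under [bar] compensates for this. *)
Lemma cyclic_perp_string (i j : 'I_(n + n)) : (i < j <= i + n)%N ->
  perp (@cat_At k n) cyclic_walks (string_rep k cyclic_pos i j) <-> j \in pblock P i.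
Proof.
move=> /andP[ij jin]; have j2n := ltn_ord j.
have n0 : (0 < n)%N by lia.
have bijP d v u := string_walk_bij k cyclic_covering i j d v u.
split=> [[_ H]|ji].
  have walkP a b t : (a < b <= a + n)%N -> (b < n + n)%N -> same_gap P a b ->
      (i <= t < j)%N -> (t = a %[mod n] -> (t + (b - a) < j)%N) /\
                        (t = b %[mod n] -> (i + (b - a) <= t)%N).
    move=> ab b2n gap /andP[it tj]; pose u : 'I_n := Ordinal (ltn_pmod a n0).
    pose v : 'I_n := Ordinal (ltn_pmod b n0).
    have au : cyclic_pos a u by rewrite cyclic_posE.
    have bv : cyclic_pos b v by rewrite cyclic_posE.
    have /H/bijP[H1 H2] : cyclic_walks (b - a) v u.
      by exists a, b; rewrite ab b2n.
    split=> tE.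
      have /H1/and3P[//] : on_string cyclic_pos i j t u.
      by rewrite /on_string it tj cyclic_posE tE -cyclic_posE.
    have /H2/andP[dt /and3P[idt _ _]] : on_string cyclic_pos i j t v.
      by rewrite /on_string it tj cyclic_posE tE -cyclic_posE.
    by lia.
  apply: same_gap_closed => // a b ab gap; have b2n := ltn_ord b; have a2n := ltn_ord a.
  have [ban|anb] := leqP b (a + n).
    have abn : (a < b <= a + n)%N by rewrite ab.
    have := walkP _ _ a abn b2n gap; have := walkP _ _ b abn b2n gap.
    by move: (nat_of_ord a) (nat_of_ord b) ab => x y xy hy hx; apply/idP/idP => h;
      [have [/(_ erefl)] := hx h | have [_ /(_ erefl)] := hy h]; lia.
  have an : (a < n)%N by lia.
  have nb : (n <= b)%N by lia.
  (* Gaps more than [n] apart have no walk of their own, but their half turn is a pair at distance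
     at most [n]. Its walk would push [b] up to a + 2n or [a] below [i], so neither gap is under the
     chord. *)
  have gap' : same_gap P (b - n) (a + n).
    have := same_gap_bar a2n b2n gap; rewrite /nbar an ltnNge nb /= => gap'.
    by move=> x y xy yx; rewrite gap'.
  have ban : (b - n < a + n <= b - n + n)%N by lia.
  have an2 : (a + n < n + n)%N by rewrite ltn_add2r.
  rewrite [LHS](_ : _ = false) ?[RHS](_ : _ = false) //.
    apply/negP => /(walkP _ _ _ ban an2 gap')[/(_ _)/wrap[]].
      by rewrite -[in LHS](subnK nb) modnDr.
    by move: j2n; lia.
  apply/negP => /(walkP _ _ _ ban an2 gap')[_ /(_ _)/wrap[]].
    by rewrite modnDr.
  by lia.
split; first by apply/cyclic_nilpotent/nilpotent_string/cyclic_covering.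
move=> d v u [a] [b] [/andP[/andP[ab ban] b2n] gap -> au bv]; apply/bijP.
have gij := gap _ _ ij ji.
have a2n : (a < n + n)%N by lia.
(* A position of the string over the vertex of a gap is the gap itself, handled by [gij], or differs
   from it by [n], handled by [gbar]. *)
have := same_gap_bar a2n b2n gap ij ji; rewrite /nbar => gbar.
split=> t /and3P[it tj tx].
  have tv : cyclic_pos (t + (b - a)) v.
    rewrite /cyclic_pos -(eqP bv) -(subnKC (ltnW ab)) addKn eqn_modDr.
    by rewrite (eqP tx) -(eqP au).
  have t2n : (t < n + n)%N by lia.
  rewrite /on_string tv; have e : a = t %[mod n] by rewrite (eqP tx) (eqP au).
  have [te|te|te] := eq_mod_2n n0 a2n t2n e.
  - by move: gij; rewrite -te it tj => /esym; clear gbar; lia.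
  - have an : (a < n)%N by lia.
    move: gbar; rewrite an -te it tj => /esym; clear gij e.
    by case: (ltnP b n) => ?; lia.
  - have an : (a < n)%N = false by lia.
    have at_ : (a - n = t)%N by lia.
    move: gbar; rewrite an at_ it tj => /esym; clear gij e.
    by case: (ltnP b n) => ?; lia.
have t2n : (t < n + n)%N by lia.
have e : b = t %[mod n] by rewrite (eqP tx) (eqP bv).
have dt : (b - a <= t)%N && (i <= t - (b - a))%N.
  have [te|te|te] := eq_mod_2n n0 b2n t2n e.
  - by move: gij; rewrite -te it tj; clear gbar; lia.
  - have bn : (b < n)%N by lia.
    move: gbar; rewrite bn -te it tj; clear gij e.
    by case: (ltnP a n) => ?; lia.
  - have bn : (b < n)%N = false by lia.
    have bt : (b - n = t)%N by lia.
    move: gbar; rewrite bn bt it tj; clear gij e.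
    by case: (ltnP a n) => ?; lia.
case/andP: dt => dt idt; rewrite dt /on_string idt /=; apply/andP; split; first by lia.
rewrite /cyclic_pos -(eqP au) -(eqn_modDr (b - a)) subnK //.
by rewrite subnKC ?(ltnW ab) // e.
Qed.

End FromPartition.

Lemma thick_cyclic :
  exists phi : thick_subcategory (@cat_At k n) -> NCB n,
     [/\ bijective phi,
         (forall C D : thick_subcategory (@cat_At k n),
            thick_le C D <-> refines (val (phi C)) (val (phi D))) &
         (forall (C : thick_subcategory (@cat_At k n)) (i j : 'I_(n + n)),
            (i < j <= i + n)%N ->
            j \in pblock (val (phi C)) i <-> sval C (uniserial_rep k n i j))].
Proof.
pose Nil := cyclic_nilpotent; pose cov := cyclic_covering.
pose lk (C : thick_subcategory (@cat_At k n)) := linked cyclic_pos (sval C).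
have ncL C : periodic_noncrossing n (lk C).
  split=> [x|x y|x y z|x y|i j i' j'].
  - exact: (linked_refl cov Nil (svalP C)).
  - exact: linked_sym.
  - exact: (linked_trans cov Nil (svalP C)).
  - by apply: (linked_shift cov Nil (svalP C)); apply: cyclic_pos_shift.
  - exact: (linked_crossing cov Nil (svalP C)).
pose E C := modulo_2n n (lk C).
have E_refl C x : E C x x by apply: modulo_2n_refl.
have E_sym C x y : E C x y -> E C y x by apply: modulo_2n_sym.
have E_trans C x y z : E C x y -> E C y z -> E C x z by apply: modulo_2n_trans.
have E_bar C (x y : 'I_(n + n)) : E C x y -> E C (bar x) (bar y).
  exact: modulo_2n_bar.
have E_short C x y : (x <= y <= x + n)%N -> E C x y <-> lk C x y by apply: modulo_2nE.
have E_part C : partition (classes_of (n + n) (E C)) [set: 'I_(n + n)].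
  exact: (classes_of_partition _ (E_refl C) (@E_sym C) (@E_trans C)).
have E_in C := in_classes_of (E_refl C) (@E_sym C) (@E_trans C).
case: (@thick_classification k _ (@cat_At k n) (n + n)
         (fun P => [&& partition P [set: 'I_(n + n)], noncrossing P &
                       [forall A in P, [set bar x | x in A] \in P]]) E) => //.
- by move=> P /andP[].
- move=> C; rewrite E_part /=; apply/andP; split.
    apply: (classes_of_noncrossing (E_refl C) (@E_sym C) (@E_trans C)).
    move=> i j i' j' iji' /andP[i'j' j'2n]; apply: modulo_2n_crossing iji' i'j' _ => //.
    exact: ltn_addl.
  by apply/(bar_closedP (E_part C)) => x y /E_in/E_bar/E_in.
- move=> C D; split=> [CD i j [p [q lpq]]|CD].
    by exists p, q; apply: CD.
  apply: (thick_le_string cov Nil (svalP C) (svalP D)) => i j.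
  (* For [n = 0] there are no vertices and every representation is zero; reducing modulo 2n requires
     [n > 0]. *)
  have [n0|n_gt0] := posnP n.
    move=> _; apply: (thick_zero (svalP D)); first exact: (ambient_string cov Nil).
    by move=> v; have := ltn_ord v; rewrite [X in (_ < X)%N]n0.
  have [ij|ji _] := leqP i j; last exact: (thick_string_nil cov Nil (svalP D) (ltnW ji)).
  rewrite -!linkedE //; move: i j ij => i j _.
  exact: (modulo_2n_sub n_gt0 (ncL C) (ncL D) CD).
- move=> P /and3P[partP ncP /(bar_closedP partP) barP].
  have thP : thick (@cat_At k n) (perp (@cat_At k n) (cyclic_walks P)).
    apply: thick_perp; exists (string_rep k cyclic_pos 0 0); split.
      exact: (ambient_string cov Nil).
    by move=> v z; apply: string_rep0.
  pose C : thick_subcategory (@cat_At k n) := exist _ _ thP.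
  have CP (i j : 'I_(n + n)) : (i < j <= i + n)%N -> E C i j <-> j \in pblock P i.
    move=> ijn; have /andP[ij jin] := ijn.
    rewrite E_short ?(ltnW ij) // /lk linkedE ?(ltnW ij) //.
    exact: cyclic_perp_string.
  have P_sym (i j : 'I_(n + n)) : j \in pblock P i -> i \in pblock P j.
    by rewrite in_pblock_sym.
  have P_refl (i : 'I_(n + n)) : i \in pblock P i by apply: in_pblock_refl.
  (* [CP] only treats chords spanning at most [n]; both relations are stable under [bar], which
     reaches all the others. *)
  exists C => i j; split; move: i j.
    apply: (bar_short_chords (F := fun x y => E C x y) (G := fun x y => y \in pblock P x)).
    + by move=> x y; apply: E_sym.
    + by move=> x y; apply: P_sym.
    + by move=> x; apply: P_refl.
    + by move=> x y; apply: E_bar.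
    + by move=> x y; apply: barP.
    + by move=> i j ijn /(CP _ _ ijn).
  apply: (bar_short_chords (F := fun x y => y \in pblock P x) (G := fun x y => E C x y)).
  + by move=> x y; apply: P_sym.
  + by move=> x y; apply: E_sym.
  + by move=> x; apply: E_refl.
  + by move=> x y; apply: barP.
  + by move=> x y; apply: E_bar.
  + by move=> i j ijn /(CP _ _ ijn).
- move=> phi [bij_phi le_phi phiE]; exists phi; split=> // C i j ijn.
  have /andP[ij jin] := ijn.
  rewrite phiE E_short ?(ltnW ij) // /lk linkedE 1?ltnW //.
  have iso := uniserial_rep_iso jin.
  split; last first.
    by apply: (thick_iso Nil (svalP C) (rep_iso_sym iso)); apply: (ambient_string cov Nil).
  apply: (thick_iso Nil (svalP C) iso).
  by apply/Nil/(nilpotent_iso iso)/nilpotent_string/cov.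
Qed.

End Cyclic.

Theorem corollary9p2 (k : fieldType) (n : nat) :
  (exists phi : thick_subcategory (@cat_A k n) -> NC n.+1,
     [/\ bijective phi,
         (forall C D : thick_subcategory (@cat_A k n),
            thick_le C D <-> refines (val (phi C)) (val (phi D))) &
         (forall (C : thick_subcategory (@cat_A k n)) (i j : 'I_n.+1),
            (i < j)%N ->
            j \in pblock (val (phi C)) i <-> sval C (interval_rep k n i j))])
  /\
  (exists phi : thick_subcategory (@cat_At k n) -> NCB n,
     [/\ bijective phi,
         (forall C D : thick_subcategory (@cat_At k n),
            thick_le C D <-> refines (val (phi C)) (val (phi D))) &
         (forall (C : thick_subcategory (@cat_At k n)) (i j : 'I_(n + n)),
            (i < j <= i + n)%N ->
            j \in pblock (val (phi C)) i <-> sval C (uniserial_rep k n i j))]).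
Proof. by split; [apply: thick_linear | apply: thick_cyclic]. Qed.
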